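(* Let $d=2$, $\kappa>0$, let $\psi_0(x)=e^{ikx}$ with $k\in\mathbb{R}^2$, $|k|=\kappa$, and let $\psi_1$ be a radiation solution of $-\Delta\psi=\kappa^2\psi$ in $\mathcal{U}\subset\mathbb{R}^2$ with far-field pattern $f_1$. Let $X=X_{s,\omega}$ with $\omega\in\mathbb{S}^1$ fixed and $s$ sufficiently large so that $X\subset\mathcal{U}$. Then $\psi_1$ on $X$ is approximately determined by the intensity $|\psi_0+\psi_1|^2$ on $X$ via the formula $$\psi_1(x)=\frac{e^{i\kappa|x|}}{|x|^{1/2}}f_1\left(\frac{x}{|x|}\right)+\mathcal{O}\left(\frac{1}{|x|^{3/2}}\right),\quad|x|\to+\infty,$$ and the following formula for $f_1$: for fixed $k$ and fixed $\theta\in\mathbb{S}^+_\omega$, with $x=\frac{s\theta}{(\theta,\omega)}\in X$, $y=x+\zeta\in X$, $\zeta\in X_{0,\omega}$, and $D=D(x,\zeta,k)\ne0$, $$f_1(\theta)=f_{1,1}-\frac1D\left(e^{i(ky-|k||y|)}-e^{i(kx-|k||x|)}\right)\frac{|f_{1,1}|^2}{|x|^{1/2}}+\frac1D\,\mathcal{O}\left(\frac{|\zeta|}{|x|}\right)+\frac{1}{D^3}\left(\mathcal{O}\left(\frac{1}{|x|}\right)+\mathcal{O}\left(\frac{|\zeta|}{|x|^{3/2}}\right)\right)$$ as $|x|\to+\infty$, $|x|/|\zeta|\to+\infty$, where $f_{1,1}=f_{1,1}(\theta)$.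
   Context: $\mathcal{U}=\mathbb{R}^2\setminus(\Omega\cup\partial\Omega)$ is connected, where $\Omega\subset\mathbb{R}^2$ is a bounded open domain with smooth boundary. For vectors, $kx=(k,x)$ denotes the Euclidean scalar product. A radiation solution is a $C^2$ solution $\psi_1$ of $-\Delta\psi_1=\kappa^2\psi_1$ in $\mathcal{U}$ satisfying $|x|^{1/2}\left(\frac{\partial}{\partial|x|}-i\kappa\right)\psi_1(x)\to0$ as $|x|\to+\infty$, uniformly in $x/|x|$. Its far-field pattern is the function $f_1$ on $\mathbb{S}^1$ for which the displayed large-$|x|$ expansion of $\psi_1$ holds. For $s\ge0$, $\omega\in\mathbb{S}^{1}$: $X_{s,\omega}=\{x\in\mathbb{R}^2:(x,\omega)=s\}$ and $\mathbb{S}^+_\omega=\{\theta\in\mathbb{S}^{1}:(\theta,\omega)>0\}$. For $x=s\theta/(\theta,\omega)$ one has $x/|x|=\theta$, $|x|=s/(\theta,\omega)$; for fixed $\theta$, $|x|\to+\infty$ means $s\to+\infty$. Definitions: $a(x,k)=|x|^{1/2}\left(|\psi_0(x)+\psi_1(x)|^2-1\right)$, $x\in\mathcal{U}$; with $y=x+\zeta$, $$D=D(x,\zeta,k)=2i\sin\big(k\zeta+|k||x|-|k||y|\big),\qquad f_{1,1}(\theta)=\frac1D\left(e^{i(ky-|k||y|)}a(x,k)-e^{i(kx-|k||x|)}a(y,k)\right)$$ (so $f_{1,1}(\theta)$ depends also on $x,\zeta,k$). Convention: ''as $|x|\to+\infty$, $|x|/|\zeta|\to+\infty$'' means that there are constants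 $C,R>0$ (depending on the fixed quantities only) such that the $\mathcal{O}$ bounds hold with constant $C$ whenever $|x|\ge R$ and $|x|/|\zeta|\ge R$. *)

(* Defs.v *)
From Stdlib Require Import Reals.
From Coquelicot Require Import Coquelicot.

Open Scope R_scope.

Definition plane : Type := (R * R)%type.

Definition padd (x y : plane) : plane := (fst x + fst y, snd x + snd y).
Definition psub (x y : plane) : plane := (fst x - fst y, snd x - snd y).
Definition pscal (t : R) (x : plane) : plane := (t * fst x, t * snd x).
Definition dot (x y : plane) : R := fst x * fst y + snd x * snd y.
Definition enorm (x : plane) : R := sqrt (dot x x).

Definition unit_vec (x : plane) : Prop := enorm x = 1.

(* x / |x|; meaningful for x <> 0 only *)
Definition direction (x : plane) : plane := pscal (/ enorm x) x.

(* Rotation by +pi/2. *)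
Definition perp (x : plane) : plane := (- snd x, fst x).

(* [open] and [locally] refer to Coquelicot's product uniform structure on
   R * R, whose topology is the Euclidean one. *)

Definition adherent (D : plane -> Prop) (x : plane) : Prop :=
  forall V : plane -> Prop, locally x V -> exists y, V y /\ D y.

Definition boundary (D : plane -> Prop) (x : plane) : Prop :=
  adherent D x /\ adherent (fun y => ~ D y) x.

Definition exterior (D : plane -> Prop) (x : plane) : Prop :=
  ~ (D x \/ boundary D x).

Definition connected (D : plane -> Prop) : Prop :=
  forall A B : plane -> Prop,
    open A -> open B ->
    (forall x, D x -> A x \/ B x) ->
    (exists x, D x /\ A x) ->
    (exists x, D x /\ B x) ->
    exists x, D x /\ A x /\ B x.

Definition bounded_set (D : plane -> Prop) : Prop :=
  exists M : R, forall x, D x -> enorm x <= M.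

(* Near each boundary point p, in the orthonormal frame (perp nu, nu) centred
   at p, the set D is the region strictly below the graph of a C^infinity
   function g.  As a smooth germ extends to the whole line, g may be taken
   smooth on all of R. *)
Definition smooth_boundary (D : plane -> Prop) : Prop :=
  forall p, boundary D p ->
    exists (nu : plane) (g : R -> R) (r : R),
      unit_vec nu /\ 0 < r /\
      (forall (n : nat) (t : R), ex_derive_n g n t) /\
      (forall x, enorm (psub x p) < r ->
         (D x <-> dot (psub x p) nu < g (dot (psub x p) (perp nu)))).

Definition smooth_bounded_domain (D : plane -> Prop) : Prop :=
  (exists x, D x) /\ open D /\ connected D /\ bounded_set D /\
  smooth_boundary D.

(* e^{it} for real t *)
Definition cexpi (t : R) : C := (cos t, sin t).

Definition re2 (psi : plane -> C) : R -> R -> R := fun u v => Re (psi (u, v)).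
Definition im2 (psi : plane -> C) : R -> R -> R := fun u v => Im (psi (u, v)).

(* On an open set U, [ex_diff_n _ 2] at every point says that all partial
   derivatives up to order 2 exist and are continuous on U. *)
Definition C2_on (U : plane -> Prop) (psi : plane -> C) : Prop :=
  forall x, U x ->
    ex_diff_n (re2 psi) 2 (fst x) (snd x) /\
    ex_diff_n (im2 psi) 2 (fst x) (snd x).

Definition laplacian2 (f : R -> R -> R) (u v : R) : R :=
  partial_derive 2 0 f u v + partial_derive 0 2 f u v.

Definition laplacian (psi : plane -> C) (x : plane) : C :=
  (laplacian2 (re2 psi) (fst x) (snd x), laplacian2 (im2 psi) (fst x) (snd x)).

Definition radial_derivative (psi : plane -> C) (x : plane) : C :=
  (Derive (fun r => Re (psi (pscal r (direction x)))) (enorm x),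
   Derive (fun r => Im (psi (pscal r (direction x)))) (enorm x)).

Definition helmholtz (kappa : R) (U : plane -> Prop) (psi : plane -> C) : Prop :=
  forall x, U x ->
    Copp (laplacian psi x) = Cmult (RtoC (kappa ^ 2)) (psi x).

Definition sommerfeld (kappa : R) (U : plane -> Prop) (psi : plane -> C) : Prop :=
  forall eps : R, 0 < eps -> exists R0 : R, forall x, U x -> R0 <= enorm x ->
    sqrt (enorm x)
      * Cmod (radial_derivative psi x - Ci * RtoC kappa * psi x)%C < eps.

Definition radiation_solution (kappa : R) (U : plane -> Prop)
    (psi : plane -> C) : Prop :=
  C2_on U psi /\ helmholtz kappa U psi /\ sommerfeld kappa U psi.

(* The leading term e^{i kappa |x|} |x|^{-1/2} f(x/|x|); only the values of f
   on the unit circle are used. *)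
Definition outgoing_term (kappa : R) (f : plane -> C) (x : plane) : C :=
  (cexpi (kappa * enorm x) / RtoC (sqrt (enorm x)) * f (direction x))%C.

Definition far_field_pattern (kappa : R) (U : plane -> Prop)
    (psi f : plane -> C) : Prop :=
  exists M R0 : R, 0 < M /\ 0 < R0 /\
    forall x, U x -> R0 <= enorm x ->
      Cmod (psi x - outgoing_term kappa f x)%C <= M / Rpower (enorm x) (3 / 2).

Definition line (s : R) (omega : plane) (x : plane) : Prop := dot x omega = s.

Definition psi0 (k : plane) (x : plane) : C := cexpi (dot k x).

Definition intensity_a (psi1 : plane -> C) (x k : plane) : R :=
  sqrt (enorm x) * (Cmod (psi0 k x + psi1 x)%C ^ 2 - 1).

Definition Dfun (x zeta k : plane) : C :=
  let y := padd x zeta in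
  (RtoC 2 * Ci
   * RtoC (sin (dot k zeta + enorm k * enorm x - enorm k * enorm y)))%C.

(* e^{i (k x - |k||x|)} *)
Definition phase (k x : plane) : C := cexpi (dot k x - enorm k * enorm x).

Definition f11 (psi1 : plane -> C) (x zeta k : plane) : C :=
  let y := padd x zeta in
  (/ Dfun x zeta k
   * (phase k y * RtoC (intensity_a psi1 x k)
      - phase k x * RtoC (intensity_a psi1 y k)))%C.

(* Main.v *)
(* The analytic core is that [f1] is Lipschitz.  In polar coordinates, the
   amplitude [g = sqrt r e^{-i kappa r} psi1] satisfies
   [g_rr + 2 i kappa g_r = - (g_tt + g / 4) / r^2] and [g = f1 + O(1/r)].  Average
   this equation in the angle against the kernel [(h - |t|)_+]: [g_tt] becomes the
   second difference of [g] with step [h], while the averaged [g] has increments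
   [O(h^2 / r)] in [r].  Integrated from [r] to [2 r], the right-hand side is
   about [1 / (2 r)] times the second difference of [f1] (up to [O(h^2 / r)]), so
   this second difference is [O(h^2)]; as [f1] is bounded, it is Lipschitz.

   Write [p], [q] for the phases at [x], [y].  The intensity at [x] gives
   [a(x) = 2 Re(conj p * f1) + |f1|^2 / sqrt |x| + O(1/|x|)], and the Lipschitz
   bound gives the same at [y] with [f1] still taken at [x / |x|], up to
   [O(|zeta| / |x|)].  The combination [q a(x) - p a(y)] eliminates [conj f1] and
   has [D = q conj p - p conj q] as coefficient of [f1]. *)

Require Import Defs.
From Stdlib Require Import Reals Lra Lia Psatz.
From Coquelicot Require Import Coquelicot.

Open Scope R_scope.

(** * Tent averages *)

(** The two points [x] and [y] see the pattern in different directions, and the discrepancy is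
    [O(|zeta| / |x|)] only if [f1] is Lipschitz at [theta], whereas [f1] comes with no regularity.
    The obstacle is that the expansion cannot be differentiated in the angle: [g = f1 + O(1/r)] says
    nothing about [g_t] or [g_tt]. Averaging avoids estimating any angular derivative. The kernel
    has mass [h^2], so an error [O(1/r)] becomes [O(h^2 / r)], of the same order in [r] as the
    integral of [1 / r^2] over [[r, 2 r]]. The powers of [r] therefore cancel, and at fixed [h] one
    may let [r] grow, which replaces the second difference of [g] by that of [f1]. *)

Lemma continuity_2d_pt_comp (f g h : R -> R -> R) (x y : R) :
  continuity_2d_pt f (g x y) (h x y) ->
  continuity_2d_pt g x y -> continuity_2d_pt h x y ->
  continuity_2d_pt (fun u v => f (g u v) (h u v)) x y.
Proof.
  intros Hf Hg Hh eps.
  destruct (Hf eps) as [d Hd].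
  destruct (Hg d) as [dg Hdg]. destruct (Hh d) as [dh Hdh].
  assert (Hm : 0 < Rmin dg dh) by (apply Rmin_pos; [apply dg | apply dh]).
  exists (mkposreal _ Hm). simpl. intros u v Hu Hv.
  pose proof (Rmin_l dg dh). pose proof (Rmin_r dg dh).
  apply Hd; [apply Hdg | apply Hdh]; lra.
Qed.

Lemma continuity_2d_pt_slice (f : R -> R -> R) (x y : R) :
  continuity_2d_pt f x y -> continuous (f x) y.
Proof.
  intros Hf. apply continuity_pt_filterlim. intros eps Heps.
  destruct (Hf (mkposreal eps Heps)) as [d Hd]. simpl in Hd.
  exists d. split; [apply d|]. intros z [_ Hz].
  apply Hd; [rewrite Rminus_diag, Rabs_R0; apply d | exact Hz].
Qed.

(** The integral of [u] against the kernel [(h - |t|)_+] centred at [c], folded at the corner of the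
    kernel so that the weight is smooth on the interval of integration. *)
Definition tent (c h : R) (u : R -> R) : R :=
  RInt (fun t => (h - t) * (u (c + t) + u (c - t))) 0 h.

Lemma tent_integrand_continuous (c h : R) (u : R -> R) (t : R) :
  (forall t, continuous u t) ->
  continuous (fun t => (h - t) * (u (c + t) + u (c - t))) t.
Proof.
  intros Hu.
  apply (continuous_mult (fun t => h - t) (fun t => u (c + t) + u (c - t))).
  - apply (continuous_minus (fun _ => h) (fun t => t));
      [apply continuous_const | apply continuous_id].
  - apply (continuous_plus (fun t => u (c + t)) (fun t => u (c - t))).
    + apply (continuous_comp (fun t => c + t) u); [|apply Hu].
      apply (continuous_plus (fun _ => c) (fun t => t));
        [apply continuous_const | apply continuous_id].
    + apply (continuous_comp (fun t => c - t) u); [|apply Hu].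
      apply (continuous_minus (fun _ => c) (fun t => t));
        [apply continuous_const | apply continuous_id].
Qed.

Lemma ex_RInt_tent (c h : R) (u : R -> R) :
  (forall t, continuous u t) ->
  ex_RInt (fun t => (h - t) * (u (c + t) + u (c - t))) 0 h.
Proof.
  intros Hu. apply (@ex_RInt_continuous R_CompleteNormedModule). intros t _.
  now apply tent_integrand_continuous.
Qed.

Lemma locally_gt (M r : R) : M < r -> locally r (fun x => M < x).
Proof.
  intros H. exists (mkposreal (r - M) ltac:(lra)). intros y Hy.
  unfold ball in Hy; simpl in Hy; unfold AbsRing_ball, abs, minus, plus, opp in Hy; simpl in Hy.
  apply Rabs_def2 in Hy. lra.
Qed.

Lemma is_derive_tent (M c h : R) (u ur : R -> R -> R) (r : R) :
  (forall r t, M < r -> is_derive (fun z => u z t) r (ur r t)) ->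
  (forall r t, M < r -> continuous (u r) t) ->
  (forall r t, M < r -> continuity_2d_pt ur r t) ->
  M < r ->
  is_derive (fun z => tent c h (u z)) r (tent c h (ur r)).
Proof.
  intros Hd Hc Hdc Hr.
  assert (Hd' : forall r t, M < r ->
    is_derive (fun z => (h - t) * (u z (c + t) + u z (c - t))) r
      ((h - t) * (ur r (c + t) + ur r (c - t)))).
  { intros r0 t H0. apply (is_derive_scal (fun z => u z (c + t) + u z (c - t))).
    apply (is_derive_plus (fun z => u z (c + t)) (fun z => u z (c - t)));
    now apply Hd. }
  unfold tent.
  rewrite (RInt_ext (fun t => (h - t) * (ur r (c + t) + ur r (c - t)))
    (fun t => Derive (fun z => (h - t) * (u z (c + t) + u z (c - t))) r)).
  2:{ intros t _. symmetry. apply is_derive_unique. now apply Hd'. }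
  apply (is_derive_RInt_param
    (fun z t => (h - t) * (u z (c + t) + u z (c - t)))).
  - apply filter_imp with (2 := locally_gt M r Hr). intros x Hx t _.
    eexists. now apply Hd'.
  - intros t _.
    apply continuity_2d_pt_ext_loc with
      (fun z t => (h - t) * (ur z (c + t) + ur z (c - t))).
    { destruct (locally_gt M r Hr) as [d Hdd]. exists d. intros a b Ha _.
      symmetry. apply is_derive_unique. apply Hd'. now apply Hdd. }
    assert (Hl : continuity_2d_pt (fun _ v => v) r t) by apply continuity_2d_pt_id2.
    apply continuity_2d_pt_mult.
    { apply continuity_2d_pt_minus; [apply continuity_2d_pt_const | exact Hl]. }
    apply continuity_2d_pt_plus.
    + apply (continuity_2d_pt_comp ur (fun z _ => z) (fun _ t => c + t)).
      * now apply Hdc.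
      * apply continuity_2d_pt_id1.
      * apply continuity_2d_pt_plus; [apply continuity_2d_pt_const | exact Hl].
    + apply (continuity_2d_pt_comp ur (fun z _ => z) (fun _ t => c - t)).
      * now apply Hdc.
      * apply continuity_2d_pt_id1.
      * apply continuity_2d_pt_minus; [apply continuity_2d_pt_const | exact Hl].
  - apply filter_imp with (2 := locally_gt M r Hr). intros x Hx.
    apply (ex_RInt_tent c h (u x)). intros t. now apply Hc.
Qed.

(* The kernel [(h - |t|)_+] is the second antiderivative of
   [delta_h - 2 delta_0 + delta_(-h)]. *)
Lemma tent_derive2 (c h : R) (u du ddu : R -> R) :
  (forall t, is_derive u t (du t)) ->
  (forall t, is_derive du t (ddu t)) ->
  (forall t, continuous ddu t) ->
  tent c h ddu = u (c + h) - 2 * u c + u (c - h).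
Proof.
  intros H1 H2 H3. unfold tent. apply is_RInt_unique.
  (* An antiderivative from one integration by parts. Its first term vanishes at both ends: the
     weight at [t = h], the difference of derivatives at [t = 0]. *)
  replace (u (c + h) - 2 * u c + u (c - h)) with
    (minus ((fun t => (h - t) * (du (c + t) - du (c - t)) + (u (c + t) + u (c - t))) h)
           ((fun t => (h - t) * (du (c + t) - du (c - t)) + (u (c + t) + u (c - t))) 0)).
  2:{ unfold minus, plus, opp; simpl. rewrite !Rplus_0_r, !Rminus_0_r. ring. }
  apply (@is_RInt_derive R_CompleteNormedModule
    (fun t => (h - t) * (du (c + t) - du (c - t)) + (u (c + t) + u (c - t)))).
  - intros t _.
    assert (E1 : Derive u (c + t) = du (c + t)) by apply is_derive_unique, H1.
    assert (E2 : Derive u (c - t) = du (c - t)) by apply is_derive_unique, H1.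
    assert (E3 : Derive du (c + t) = ddu (c + t)) by apply is_derive_unique, H2.
    assert (E4 : Derive du (c - t) = ddu (c - t)) by apply is_derive_unique, H2.
    auto_derive.
    + repeat split; eexists; (apply H1 || apply H2).
    + change (fun x => u x) with u; change (fun x => du x) with du.
      change (c + - t) with (c - t). rewrite E1, E2, E3, E4. ring.
  - intros t _. now apply tent_integrand_continuous.
Qed.

Lemma tent_Rabs_le (c h B : R) (u : R -> R) :
  0 <= h -> (forall t, continuous u t) ->
  (forall t, Rabs (t - c) <= h -> Rabs (u t) <= B) ->
  Rabs (tent c h u) <= 2 * B * h ^ 2.
Proof.
  intros Hh Hc HB. unfold tent.
  (* Twice the sharp bound: the weight [h - t] is simply bounded by [h]. *)
  replace (2 * B * h ^ 2) with ((h - 0) * (h * (B + B))) by ring.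
  apply abs_RInt_le_const; [exact Hh | now apply ex_RInt_tent |].
  intros t Ht. rewrite Rabs_mult. apply Rmult_le_compat; try apply Rabs_pos.
  - rewrite Rabs_pos_eq; lra.
  - eapply Rle_trans; [apply Rabs_triang|]. apply Rplus_le_compat; apply HB.
    + replace (c + t - c) with t by ring. rewrite Rabs_pos_eq; lra.
    + replace (c - t - c) with (- t) by ring. rewrite Rabs_Ropp, Rabs_pos_eq; lra.
Qed.

Lemma tent_lin (c h a b : R) (u v : R -> R) :
  (forall t, continuous u t) -> (forall t, continuous v t) ->
  tent c h (fun t => a * u t + b * v t) = a * tent c h u + b * tent c h v.
Proof.
  intros Hu Hv. unfold tent.
  apply is_RInt_unique.
  apply is_RInt_ext with (fun t => plus
     (scal a ((h - t) * (u (c + t) + u (c - t))))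
     (scal b ((h - t) * (v (c + t) + v (c - t))))).
  { intros t _. unfold plus, scal; simpl; unfold mult; simpl. ring. }
  apply (@is_RInt_plus R_NormedModule).
  - apply (@is_RInt_scal R_NormedModule). apply (@RInt_correct R_CompleteNormedModule).
    now apply ex_RInt_tent.
  - apply (@is_RInt_scal R_NormedModule). apply (@RInt_correct R_CompleteNormedModule).
    now apply ex_RInt_tent.
Qed.

(** * The radial equation *)

Lemma MVT_is_derive (f df : R -> R) (a b : R) :
  a < b -> (forall x, a <= x <= b -> is_derive f x (df x)) ->
  exists c, a <= c <= b /\ f b - f a = df c * (b - a).
Proof.
  intros Hab Hd.
  destruct (MVT_gen f a b df) as [c Hc].
  - rewrite Rmin_left, Rmax_right by lra. intros x Hx. apply Hd. lra.
  - rewrite Rmin_left, Rmax_right by lra. intros x Hx.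
    apply derivable_continuous_pt. exists (df x). apply is_derive_Reals. now apply Hd.
  - rewrite Rmin_left, Rmax_right in Hc by lra. now exists c.
Qed.

(* Two mean value steps: over a unit window to trade [p'] for increments of
   [p], then between [s] and [s + r] to reach [P' = - H / r^2]. *)
Lemma radial_ode_bound (kappa M e : R) (p q P H : R -> R) :
  0 <= kappa -> 0 <= M ->
  (forall r, M < r -> is_derive p r (P r + 2 * kappa * q r)) ->
  (forall r, M < r -> is_derive P r (- H r / r ^ 2)) ->
  (forall r r', M < r -> r <= r' -> Rabs (p r' - p r) <= e / r) ->
  (forall r r', M < r -> r <= r' -> Rabs (q r' - q r) <= e / r) ->
  forall R0, exists r, R0 < r /\ M < r /\ Rabs (H r) <= 18 * (1 + kappa) * e.
Proof.
  intros Hk HM Hp HP Hpc Hqc R0.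
  set (r := Rmax (Rmax 1 R0) M + 1).
  assert (Hr1 : 1 < r /\ R0 < r /\ M < r).
  { unfold r. pose proof (Rmax_l (Rmax 1 R0) M). pose proof (Rmax_r (Rmax 1 R0) M).
    pose proof (Rmax_l 1 R0). pose proof (Rmax_r 1 R0). lra. }
  destruct Hr1 as (Hr1 & HrR & HrM). clearbody r.
  (* The derivative of [p (s + r) - p s] contains [P (s + r) - P s], while its change over a window
     of length one consists of two increments of [p], each at most [e / r]. *)
  destruct (MVT_is_derive (fun s => p (s + r) - p s)
     (fun s => (P (s + r) + 2 * kappa * q (s + r)) - (P s + 2 * kappa * q s))
     r (r + 1)) as (s & Hs & Es); [lra | |].
  { intros x Hx. apply (is_derive_minus (fun s => p (s + r)) p); [|apply Hp; lra].
    replace (P (x + r) + 2 * kappa * q (x + r)) with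
      (1 * (P (x + r) + 2 * kappa * q (x + r))) by ring.
    apply (is_derive_comp p (fun s => s + r)); [apply Hp; lra|].
    auto_derive; [trivial | ring]. }
  destruct (MVT_is_derive P (fun x => - H x / x ^ 2) s (s + r)) as (x & Hx & Ex);
    [lra | |].
  { intros x Hx. apply HP. lra. }
  exists x. split; [lra|]. split; [lra|].
  assert (He : 0 <= e).
  { pose proof (Hpc r r HrM (Rle_refl r)) as A. pose proof (Rabs_pos (p r - p r)).
    assert (0 <= e / r) by lra.
    replace e with (e / r * r) by (field; lra). apply Rmult_le_pos; lra. }
  assert (Hmon : forall t, r <= t -> e / t <= e / r).
  { intros t Ht. apply Rmult_le_compat_l; [exact He|]. apply Rinv_le_contravar; lra. }
  assert (A1 := Hpc (r + 1) (r + 1 + r) ltac:(lra) ltac:(lra)).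
  assert (A2 := Hpc r (r + r) ltac:(lra) ltac:(lra)).
  assert (A3 := Hqc s (s + r) ltac:(lra) ltac:(lra)).
  pose proof (Hmon (r + 1) ltac:(lra)). pose proof (Hmon s ltac:(lra)).
  assert (B : Rabs (P (s + r) - P s) <= 2 * (1 + kappa) * (e / r)).
  { replace (P (s + r) - P s) with
      ((p (r + 1 + r) - p (r + 1)) - (p (r + r) - p r)
         - 2 * kappa * (q (s + r) - q s)) by lra.
    apply Rle_trans with (e / r + e / r + 2 * kappa * (e / r)); [|lra].
    eapply Rle_trans; [apply Rabs_triang|]. rewrite Rabs_Ropp.
    apply Rplus_le_compat.
    - eapply Rle_trans; [apply Rabs_triang|]. rewrite Rabs_Ropp. lra.
    - rewrite Rabs_mult, (Rabs_pos_eq (2 * kappa)) by lra.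
      apply Rmult_le_compat_l; lra. }
  rewrite Ex in B.
  replace (H x) with (- (- H x / x ^ 2 * (s + r - s)) * (x ^ 2 / r)) by (field; lra).
  assert (Hx0 : 0 <= x ^ 2 / r).
  { apply Rmult_le_pos; [apply pow2_ge_0 | apply Rlt_le, Rinv_0_lt_compat; lra]. }
  rewrite Rabs_mult, Rabs_Ropp, (Rabs_pos_eq (x ^ 2 / r)) by exact Hx0.
  apply Rle_trans with (2 * (1 + kappa) * (e / r) * (x ^ 2 / r)).
  { now apply Rmult_le_compat_r. }
  (* Here [x <= s + r <= 2 * r + 1 <= 3 * r], as [r > 1]. The square of 3 times the factor 2 in [B]
     gives the constant 18. *)
  assert (Hq : x / r <= 3).
  { apply Rmult_le_reg_r with r; [lra|]. replace (x / r * r) with x by (field; lra). lra. }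
  assert (Hq0 : 0 <= x / r).
  { apply Rmult_le_pos; [lra | apply Rlt_le, Rinv_0_lt_compat; lra]. }
  replace (2 * (1 + kappa) * (e / r) * (x ^ 2 / r)) with
    (2 * (1 + kappa) * e * (x / r) ^ 2) by (field; lra).
  replace (18 * (1 + kappa) * e) with (2 * (1 + kappa) * e * 3 ^ 2) by ring.
  apply Rmult_le_compat_l; [repeat apply Rmult_le_pos; lra|].
  apply pow_incr; lra.
Qed.

(** The Helmholtz equation in polar coordinates for [r > M], solved for [u_rr]. Joint continuity of
    [ur] and [urr] serves differentiation under the angular integral; [utt] is only integrated in
    the angle, so continuity in [t] is enough for it. *)
Definition polar_helmholtz (kappa M : R) (u : R -> R -> R) : Prop :=
  exists ur urr ut utt : R -> R -> R, forall r t, M < r ->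
    is_derive (fun z => u z t) r (ur r t) /\
    is_derive (fun z => ur z t) r (urr r t) /\
    is_derive (u r) t (ut r t) /\
    is_derive (ut r) t (utt r t) /\
    continuity_2d_pt ur r t /\
    continuity_2d_pt urr r t /\
    continuous (utt r) t /\
    urr r t = - (ur r t / r) - utt r t / r ^ 2 - kappa ^ 2 * u r t.

Lemma polar_helmholtz_continuous (kappa M : R) (u : R -> R -> R) (r t : R) :
  polar_helmholtz kappa M u -> M < r -> continuous (u r) t.
Proof.
  intros (ur & urr & ut & utt & Hu) Hr.
  apply (ex_derive_continuous (V := R_NormedModule)). eexists. apply (Hu r t Hr).
Qed.

(** Averaging commutes with the radial derivatives and turns [u_tt] into a second difference, so the
    partial differential equation becomes an ordinary one in [r] with a source term. *)
Lemma polar_helmholtz_tent (kappa M c h : R) (u : R -> R -> R) :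
  0 <= M -> polar_helmholtz kappa M u ->
  exists w : R -> R, forall r, M < r ->
    is_derive (fun z => tent c h (u z)) r (w r) /\
    is_derive w r (- (w r / r)
      - (u r (c + h) - 2 * u r c + u r (c - h)) / r ^ 2
      - kappa ^ 2 * tent c h (u r)).
Proof.
  intros HM Hpol. pose proof Hpol as (ur & urr & ut & utt & Hu).
  exists (fun r => tent c h (ur r)). intros r Hr.
  assert (Cu : forall r t, M < r -> continuous (u r) t).
  { intros. now apply (polar_helmholtz_continuous kappa M). }
  assert (Cur : forall r t, M < r -> continuous (ur r) t).
  { intros r' t H'. apply continuity_2d_pt_slice. now apply Hu. }
  split.
  - apply (is_derive_tent M c h u ur); try assumption; now apply Hu.
  - assert (E : tent c h (urr r) = - (tent c h (ur r) / r)
      - (u r (c + h) - 2 * u r c + u r (c - h)) / r ^ 2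
      - kappa ^ 2 * tent c h (u r)).
    { rewrite <- (tent_derive2 c h (u r) (ut r) (utt r)) by (intros t; now apply Hu).
      assert (Cu1 : forall t, continuous (fun t => - / r * ur r t + - / r ^ 2 * utt r t) t).
      { intros t. apply (continuous_plus (fun t => - / r * ur r t) (fun t => - / r ^ 2 * utt r t)).
        - apply (continuous_mult (fun _ => - / r) (ur r)); [apply continuous_const|now apply Cur].
        - apply (continuous_mult (fun _ => - / r ^ 2) (utt r)); [apply continuous_const|now apply Hu]. }
      transitivity (tent c h (fun t => 1 * (- / r * ur r t + - / r ^ 2 * utt r t)
                                       + (- kappa ^ 2) * u r t)).
      - unfold tent. apply RInt_ext. intros t _.
        destruct (Hu r (c + t) Hr) as (_ & _ & _ & _ & _ & _ & _ & E1).
        destruct (Hu r (c - t) Hr) as (_ & _ & _ & _ & _ & _ & _ & E2).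
        rewrite E1, E2. apply Rminus_diag_uniq. field. lra.
      - rewrite tent_lin; [|assumption | intros; now apply Cu].
        rewrite tent_lin; [field; lra | intros; now apply Cur | intros; now apply Hu]. }
    rewrite <- E. apply (is_derive_tent M c h ur urr); try assumption; now apply Hu.
Qed.

(* The real part of [sqrt r e^{-i kappa r} (u + i v)]; the imaginary part is
   the same expression for the pair [(v, - u)]. *)
Definition amplitude (kappa : R) (u v : R -> R) (r : R) : R :=
  sqrt r * (u r * cos (kappa * r) + v r * sin (kappa * r)).

Lemma is_derive_amplitude (kappa : R) (u v : R -> R) (r u1 v1 : R) :
  0 < r -> is_derive u r u1 -> is_derive v r v1 ->
  is_derive (amplitude kappa u v) r
    (/ (2 * r) * amplitude kappa u v r
     + amplitude kappa (fun _ => u1) (fun _ => v1) r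
     + kappa * amplitude kappa v (fun r => - u r) r).
Proof.
  intros Hr Hu Hv.
  assert (Eu : Derive u r = u1) by now apply is_derive_unique.
  assert (Ev : Derive v r = v1) by now apply is_derive_unique.
  unfold amplitude. auto_derive.
  - repeat split; try (eexists; eassumption); lra.
  - change (fun x => u x) with u; change (fun x => v x) with v. rewrite Eu, Ev.
    assert (Hs : 0 < sqrt r) by now apply sqrt_lt_R0.
    assert (Es : r = sqrt r * sqrt r) by (symmetry; apply sqrt_sqrt; lra).
    generalize (cos (kappa * r)) (sin (kappa * r)) (u r) (v r). intros co si a b.
    set (s := sqrt r) in *. rewrite Es. field. lra.
Qed.

(** With [p], [q] the real and imaginary parts of the amplitude, [P = p' - 2 kappa q] is the real
    part of [g' + 2 i kappa g]. The factor [sqrt r] cancels the first-order term [u1 / r] and leaves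
    the term with [1 / 4] in its place. *)
Lemma amplitude_ode (kappa M : R) (u v u1 v1 du dv : R -> R) :
  0 <= M ->
  (forall r, M < r -> is_derive u r (u1 r)) ->
  (forall r, M < r -> is_derive v r (v1 r)) ->
  (forall r, M < r ->
     is_derive u1 r (- (u1 r / r) - du r / r ^ 2 - kappa ^ 2 * u r)) ->
  (forall r, M < r ->
     is_derive v1 r (- (v1 r / r) - dv r / r ^ 2 - kappa ^ 2 * v r)) ->
  exists P, forall r, M < r ->
    is_derive (amplitude kappa u v) r
      (P r + 2 * kappa * amplitude kappa v (fun r => - u r) r) /\
    is_derive P r
      (- (amplitude kappa du dv r + amplitude kappa u v r / 4) / r ^ 2).
Proof.
  intros HM Hu Hv Hu1 Hv1.
  exists (fun r => / (2 * r) * amplitude kappa u v r + amplitude kappa u1 v1 r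
             - kappa * amplitude kappa v (fun r => - u r) r).
  intros r Hr. assert (Hr0 : 0 < r) by lra.
  pose proof (is_derive_amplitude kappa u v r _ _ Hr0 (Hu r Hr) (Hv r Hr)) as D1.
  split.
  - replace (_ + _) with (/ (2 * r) * amplitude kappa u v r
     + amplitude kappa (fun _ => u1 r) (fun _ => v1 r) r
     + kappa * amplitude kappa v (fun r => - u r) r); [exact D1|].
    unfold amplitude. ring.
  - pose proof (is_derive_amplitude kappa u1 v1 r _ _ Hr0 (Hu1 r Hr) (Hv1 r Hr)) as D2.
    pose proof (is_derive_amplitude kappa v (fun r => - u r) r _ _ Hr0 (Hv r Hr)
       (is_derive_opp _ _ _ (Hu r Hr))) as D3.
    assert (D0 : is_derive (fun r => / (2 * r)) r (- / (2 * r ^ 2))).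
    { auto_derive; [lra|]. field. lra. }
    pose proof (is_derive_minus _ _ _ _ _
      (is_derive_plus _ _ _ _ _ (is_derive_mult _ _ _ _ _ D0 D1 Rmult_comm) D2)
      (is_derive_scal _ _ kappa _ D3)) as D.
    match type of D with is_derive ?f _ ?l =>
      match goal with |- is_derive ?g _ ?m => replace m with l; [exact D|] end end.
    unfold amplitude, minus, plus, opp, mult, scal; simpl; unfold mult; simpl.
    generalize (cos (kappa * r)) (sin (kappa * r)) (sqrt r). intros co si s.
    field. lra.
Qed.

(** * From second differences of the far-field pattern to a Lipschitz bound *)

Definition second_difference (f : R -> R) (c h : R) : R :=
  f (c + h) - 2 * f c + f (c - h).

Lemma far_field_second_difference (kappa M C B c h : R) (u v : R -> R -> R)
    (F G : R -> R) :
  0 <= kappa -> 1 <= M ->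
  polar_helmholtz kappa M u -> polar_helmholtz kappa M v ->
  (forall r t, M < r ->
     Rabs (amplitude kappa (fun r => u r t) (fun r => v r t) r - F t) <= C / r) ->
  (forall r t, M < r ->
     Rabs (amplitude kappa (fun r => v r t) (fun r => - u r t) r - G t) <= C / r) ->
  0 <= h -> (forall t, Rabs (t - c) <= h -> Rabs (F t) <= B) ->
  Rabs (second_difference F c h) <= (72 * (1 + kappa) * C + C + B) * h ^ 2.
Proof.
  intros Hk HM Hu Hv HF HG Hh HB.
  assert (HC : 0 <= C).
  { pose proof (HF (M + 1) c ltac:(lra)) as A.
    pose proof (Rabs_pos (amplitude kappa (fun r => u r c) (fun r => v r c) (M + 1) - F c)).
    replace C with (C / (M + 1) * (M + 1)) by (field; lra). apply Rmult_le_pos; lra. }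
  assert (Cu : forall r t, M < r -> continuous (u r) t).
  { intros. now apply (polar_helmholtz_continuous kappa M). }
  assert (Cv : forall r t, M < r -> continuous (v r) t).
  { intros. now apply (polar_helmholtz_continuous kappa M). }
  destruct (polar_helmholtz_tent kappa M c h u ltac:(lra) Hu) as [u1 Hu1].
  destruct (polar_helmholtz_tent kappa M c h v ltac:(lra) Hv) as [v1 Hv1].
  set (tu := fun r => tent c h (u r)) in *.
  set (tv := fun r => tent c h (v r)) in *.
  destruct (amplitude_ode kappa M tu tv u1 v1
    (fun r => second_difference (u r) c h) (fun r => second_difference (v r) c h))
    as [P HP]; [lra | now apply Hu1 | now apply Hv1 | now apply Hu1 | now apply Hv1 |].
  (* At fixed [r] the amplitude is a linear combination of [u] and [v] with coefficients free of the
     angle, so it commutes with the average. *)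
  assert (Tp : forall r, M < r -> amplitude kappa tu tv r =
     tent c h (fun t => amplitude kappa (fun r => u r t) (fun r => v r t) r)).
  { intros r Hr.
    transitivity (tent c h (fun t => sqrt r * cos (kappa * r) * u r t
                                   + sqrt r * sin (kappa * r) * v r t)).
    - rewrite tent_lin by (intros; now auto). unfold amplitude, tu, tv. ring.
    - unfold tent. apply RInt_ext. intros t _. unfold amplitude. apply Rminus_diag_uniq. ring. }
  assert (Tq : forall r, M < r -> amplitude kappa tv (fun r => - tu r) r =
     tent c h (fun t => amplitude kappa (fun r => v r t) (fun r => - u r t) r)).
  { intros r Hr.
    transitivity (tent c h (fun t => sqrt r * cos (kappa * r) * v r t
                                   + (- sqrt r * sin (kappa * r)) * u r t)).
    - rewrite tent_lin by (intros; now auto). unfold amplitude, tu, tv. ring.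
    - unfold tent. apply RInt_ext. intros t _. unfold amplitude. apply Rminus_diag_uniq. ring. }
  assert (Ca : forall r t, M < r ->
    continuous (fun t => amplitude kappa (fun r => u r t) (fun r => v r t) r) t).
  { intros r t Hr. unfold amplitude.
    apply (continuous_mult (fun _ => sqrt r)); [apply continuous_const|].
    apply (continuous_plus (fun t => u r t * cos (kappa * r))).
    - apply (continuous_mult (u r) (fun _ => cos (kappa * r))); [now apply Cu | apply continuous_const].
    - apply (continuous_mult (v r) (fun _ => sin (kappa * r))); [now apply Cv | apply continuous_const]. }
  assert (Cb : forall r t, M < r ->
    continuous (fun t => amplitude kappa (fun r => v r t) (fun r => - u r t) r) t).
  { intros r t Hr. unfold amplitude.
    apply (continuous_mult (fun _ => sqrt r)); [apply continuous_const|].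
    apply (continuous_plus (fun t => v r t * cos (kappa * r))).
    - apply (continuous_mult (v r) (fun _ => cos (kappa * r))); [now apply Cv | apply continuous_const].
    - apply (continuous_mult (fun t => - u r t) (fun _ => sin (kappa * r))); [|apply continuous_const].
      apply (continuous_opp (u r)). now apply Cu. }
  (* Both radii are within [C / r] of the same limit, and the kernel contributes [2 * h ^ 2]: hence
     [4 * C * h ^ 2 / r]. *)
  assert (Hcauchy : forall (a : R -> R -> R) (X : R -> R),
    (forall r t, M < r -> continuous (a r) t) ->
    (forall r t, M < r -> Rabs (a r t - X t) <= C / r) ->
    forall r r', M < r -> r <= r' ->
      Rabs (tent c h (a r') - tent c h (a r)) <= 4 * C * h ^ 2 / r).
  { intros a X HaC HaX r r' Hr Hr'.
    replace (tent c h (a r') - tent c h (a r)) with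
      (tent c h (fun t => 1 * a r' t + -1 * a r t)).
    2:{ rewrite tent_lin; [ring | |]; intros t; apply HaC; lra. }
    replace (4 * C * h ^ 2 / r) with (2 * (2 * C / r) * h ^ 2) by (field; lra).
    apply tent_Rabs_le; [exact Hh | |].
    - intros t. apply (continuous_plus (fun t => 1 * a r' t) (fun t => -1 * a r t)).
      + apply (continuous_mult (fun _ => 1) (a r')); [apply continuous_const | apply HaC; lra].
      + apply (continuous_mult (fun _ => -1) (a r)); [apply continuous_const | apply HaC; lra].
    - intros t _.
      replace (1 * a r' t + -1 * a r t) with ((a r' t - X t) - (a r t - X t)) by ring.
      eapply Rle_trans; [apply Rabs_triang|]. rewrite Rabs_Ropp.
      pose proof (HaX r t Hr). pose proof (HaX r' t ltac:(lra)).
      assert (C / r' <= C / r).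
      { apply Rmult_le_compat_l; [exact HC|]. apply Rinv_le_contravar; lra. }
      replace (2 * C / r) with (C / r + C / r) by (field; lra). lra. }
  pose proof (radial_ode_bound kappa M (4 * C * h ^ 2)
     (amplitude kappa tu tv) (amplitude kappa tv (fun r => - tu r)) P _
     Hk ltac:(lra) (fun r Hr => proj1 (HP r Hr)) (fun r Hr => proj2 (HP r Hr))) as Hode.
  (* Both increment hypotheses are [Hcauchy], transported along [Tp] for the real part and along
     [Tq] for the imaginary part. *)
  assert (Hlarge := Hode
    (fun r r' Hr Hr' => eq_rect_r (fun z => Rabs (z - _) <= _)
       (eq_rect_r (fun z => Rabs (_ - z) <= _) (Hcauchy _ F Ca HF r r' Hr Hr') (Tp r Hr))
       (Tp r' (Rlt_le_trans _ _ _ Hr Hr')))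
    (fun r r' Hr Hr' => eq_rect_r (fun z => Rabs (z - _) <= _)
       (eq_rect_r (fun z => Rabs (_ - z) <= _) (Hcauchy _ G Cb HG r r' Hr Hr') (Tq r Hr))
       (Tq r' (Rlt_le_trans _ _ _ Hr Hr')))).
  (* Passing from the second difference of the amplitude to that of [F] costs [4 * C / r], which
     carries no factor [h ^ 2]. It is made smaller than an arbitrary [eps] because
     [radial_ode_bound] supplies arbitrarily large radii. *)
  clear Hode. apply le_epsilon. intros eps Heps.
  destruct (Hlarge (4 * C / eps)) as (r & Hr1 & Hr2 & Hr3).
  set (a := fun t => amplitude kappa (fun r => u r t) (fun r => v r t) r).
  assert (Ea : amplitude kappa (fun r => second_difference (u r) c h)
      (fun r => second_difference (v r) c h) r = second_difference a c h).
  { unfold second_difference, a, amplitude. ring. }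
  rewrite Ea, (Tp r Hr2) in Hr3. fold a in Hr3.
  assert (HaB : Rabs (tent c h a) <= 2 * (B + C) * h ^ 2).
  { apply tent_Rabs_le; [exact Hh | intros; now apply Ca |].
    intros t Ht. pose proof (HF r t Hr2) as A. fold (a t) in A. specialize (HB t Ht).
    assert (C / r <= C).
    { apply Rmult_le_reg_r with r; [lra|].
      replace (C / r * r) with (C * 1) by (field; lra). apply Rmult_le_compat_l; lra. }
    replace (a t) with (F t + (a t - F t)) by ring.
    eapply Rle_trans; [apply Rabs_triang|]. lra. }
  assert (Hsmall : 4 * (C / r) <= eps).
  { apply Rmult_le_reg_r with (r / eps); [apply Rdiv_lt_0_compat; lra|].
    replace (4 * (C / r) * (r / eps)) with (4 * C / eps) by (field; lra).
    replace (eps * (r / eps)) with r by (field; lra). lra. }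
  assert (HB0 : 0 <= B).
  { eapply Rle_trans; [apply Rabs_pos | apply (HB c)]. rewrite Rminus_diag, Rabs_R0. exact Hh. }
  pose proof (pow2_ge_0 h) as Hh2.
  pose proof (Rmult_le_pos _ _ HC Hh2). pose proof (Rmult_le_pos _ _ HB0 Hh2).
  pose proof (HF r (c + h) Hr2) as F1. pose proof (HF r c Hr2) as F2.
  pose proof (HF r (c - h) Hr2) as F3.
  fold (a (c + h)) in F1. fold (a c) in F2. fold (a (c - h)) in F3.
  apply Rabs_le_between in F1, F2, F3, HaB, Hr3.
  apply Rabs_le_between. unfold second_difference in *. split; nra.
Qed.

(* [A h - K h^2 / 2] is preserved by [d (2 h) = 2 d h + O(K h^2)], where
   [d h = F (c + h) - F c]. *)
Lemma lipschitz_of_second_difference (F : R -> R) (c K B t : R) :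
  0 <= K -> (forall t, Rabs (t - c) <= 1 -> Rabs (F t) <= B) ->
  (forall x h, 0 <= h -> Rabs (x - c) + h <= 1 ->
     Rabs (second_difference F x h) <= K * h ^ 2) ->
  Rabs (t - c) <= 1 -> Rabs (F t - F c) <= (4 * B + K) * Rabs (t - c).
Proof.
  intros HK HB HD Ht.
  assert (Hc : Rabs (F c) <= B).
  { apply HB. rewrite Rminus_diag, Rabs_R0. lra. }
  assert (HB0 : 0 <= B) by (pose proof (Rabs_pos (F c)); lra).
  (* For such [h] the trivial bound [2 * B] is at most [4 * B * Rabs h], and the terms in [K] have a
     nonnegative sum. *)
  assert (Base : forall h, 1 / 2 <= Rabs h <= 1 ->
     Rabs (F (c + h) - F c) <= (4 * B + K) * Rabs h - K / 2 * Rabs h ^ 2).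
  { intros h Hh. apply Rle_trans with (2 * B).
    - assert (Rabs (F (c + h)) <= B) by (apply HB; replace (c + h - c) with h by ring; lra).
      eapply Rle_trans; [apply Rabs_triang|]. rewrite Rabs_Ropp. lra.
    - pose proof (Rmult_le_pos K (Rabs h * (1 - Rabs h / 2)) HK ltac:(apply Rmult_le_pos; lra)).
      pose proof (Rmult_le_pos B (Rabs h - 1 / 2) HB0 ltac:(lra)). nra. }
  assert (Ind : forall n h, (1 / 2) ^ S n <= Rabs h <= 1 ->
     Rabs (F (c + h) - F c) <= (4 * B + K) * Rabs h - K / 2 * Rabs h ^ 2).
  { induction n as [|n IH]; intros h Hh.
    - apply Base. simpl in Hh. lra.
    - destruct (Rle_lt_dec (1 / 2) (Rabs h)) as [H|H]; [apply Base; lra|].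
      assert (E2 : Rabs (2 * h) = 2 * Rabs h) by (rewrite Rabs_mult, (Rabs_pos_eq 2); lra).
      specialize (IH (2 * h)). rewrite E2 in IH.
      assert (I := IH ltac:(simpl in *; lra)).
      (* Centred at [c + h], the outer points are [c] and [c + 2 * h], so the second difference is
         [d (2 h) - 2 d h]. The step [Rabs h] covers both signs of [h]. *)
      specialize (HD (c + h) (Rabs h) (Rabs_pos h)).
      replace (c + h - c) with h in HD by ring. specialize (HD ltac:(lra)).
      assert (ES : second_difference F (c + h) (Rabs h)
         = (F (c + 2 * h) - F c) - 2 * (F (c + h) - F c)).
      { unfold second_difference, Rabs. destruct (Rcase_abs h).
        - replace (c + h + - h) with c by ring. replace (c + h - - h) with (c + 2 * h) by ring. ring.
        - replace (c + h - h) with c by ring. replace (c + h + h) with (c + 2 * h) by ring. ring. }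
      rewrite ES in HD. apply Rabs_le_between in HD, I. apply Rabs_le_between. lra. }
  destruct (Req_dec t c) as [->|Htc].
  { rewrite !Rminus_diag, Rabs_R0. lra. }
  assert (Hpos : 0 < Rabs (t - c)) by (apply Rabs_pos_lt; lra).
  destruct (pow_lt_1_zero (1 / 2) ltac:(rewrite Rabs_pos_eq; lra) _ Hpos) as [n Hn].
  specialize (Hn (S n) ltac:(lia)). apply Rabs_def2 in Hn.
  specialize (Ind n (t - c)). replace (c + (t - c)) with t in Ind by ring.
  specialize (Ind ltac:(lra)).
  pose proof (pow2_ge_0 (Rabs (t - c))). nra.
Qed.

(** * Polar coordinates *)

(** The classical criterion with one partial derivative continuous at the point. A neighbourhood is
    required because [ex_diff_n] asserts existence of the partial derivatives at a single point
    only. *)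
Lemma ex_diff_1_differentiable (f : R -> R -> R) (x y : R) :
  locally_2d (ex_diff_n f 1) x y ->
  differentiable_pt_lim f x y (Derive (fun z => f z y) x) (Derive (f x) y).
Proof.
  intros Hf. apply filterdiff_differentiable_pt_lim.
  pose proof (locally_2d_singleton _ _ _ Hf) as (_ & _ & Hy & (Hc & _) & _).
  apply (is_derive_filterdiff f x y (fun u v => Derive (fun z => f z v) u)).
  - apply locally_2d_locally in Hf. apply filter_imp with (2 := Hf).
    intros [u v] (_ & H & _). now apply Derive_correct.
  - now apply Derive_correct.
  - now apply continuity_2d_pt_filterlim in Hc.
Qed.

Lemma locally_2d_outside_disc (M x y : R) :
  M < x ^ 2 + y ^ 2 -> locally_2d (fun u v => M < u ^ 2 + v ^ 2) x y.
Proof.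
  intros H.
  assert (Hc : continuity_2d_pt (fun u v => u * u + v * v) x y).
  { apply (continuity_2d_pt_plus (fun u _ => u * u) (fun _ v => v * v)).
    - apply continuity_2d_pt_mult; apply continuity_2d_pt_id1.
    - apply continuity_2d_pt_mult; apply continuity_2d_pt_id2. }
  destruct (Hc (mkposreal (x ^ 2 + y ^ 2 - M) ltac:(lra))) as [d Hd].
  exists d. intros u v Hu Hv. specialize (Hd u v Hu Hv). simpl in Hd.
  apply Rabs_def2 in Hd. simpl. lra.
Qed.

(** Angles are measured from [theta], so the direction of interest is always [t = 0] and no global
    angle function is involved. *)
Definition rot_fst (theta : plane) (t : R) : R := fst theta * cos t - snd theta * sin t.
Definition rot_snd (theta : plane) (t : R) : R := snd theta * cos t + fst theta * sin t.

Lemma unit_vec_dot (x : plane) : unit_vec x -> dot x x = 1.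
Proof.
  unfold unit_vec, enorm. intros H.
  assert (H0 : 0 <= dot x x) by (unfold dot; nra).
  rewrite <- (sqrt_sqrt _ H0), H. ring.
Qed.

Lemma frame_norm (theta : plane) (t : R) : unit_vec theta -> rot_fst theta t ^ 2 + rot_snd theta t ^ 2 = 1.
Proof.
  intros Hu. unfold rot_fst, rot_snd.
  transitivity (dot theta theta * ((sin t)² + (cos t)²)).
  - unfold dot, Rsqr. ring.
  - rewrite unit_vec_dot, sin2_cos2 by exact Hu. ring.
Qed.

Lemma is_derive_frame (theta : plane) (t : R) : is_derive (rot_fst theta) t (- rot_snd theta t) /\ is_derive (rot_snd theta) t (rot_fst theta t).
Proof. unfold rot_fst, rot_snd. split; (auto_derive; [trivial | ring]). Qed.

Lemma is_derive_radial (theta : plane) (f : R -> R -> R) (r t fx fy : R) :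
  differentiable_pt_lim f (r * rot_fst theta t) (r * rot_snd theta t) fx fy ->
  is_derive (fun z => f (z * rot_fst theta t) (z * rot_snd theta t)) r (fx * rot_fst theta t + fy * rot_snd theta t).
Proof.
  intros Hf. apply is_derive_Reals.
  apply (derivable_pt_lim_comp_2d f (fun z => z * rot_fst theta t) (fun z => z * rot_snd theta t)); [exact Hf | |];
    apply is_derive_Reals; (auto_derive; [trivial | ring]).
Qed.

Lemma is_derive_angular (theta : plane) (f : R -> R -> R) (r t fx fy : R) :
  differentiable_pt_lim f (r * rot_fst theta t) (r * rot_snd theta t) fx fy ->
  is_derive (fun z => f (r * rot_fst theta z) (r * rot_snd theta z)) t (r * (fy * rot_fst theta t - fx * rot_snd theta t)).
Proof.
  intros Hf. destruct (is_derive_frame theta t) as [Hc Hs]. apply is_derive_Reals.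
  replace (r * (fy * rot_fst theta t - fx * rot_snd theta t)) with (fx * (r * - rot_snd theta t) + fy * (r * rot_fst theta t)) by ring.
  apply (derivable_pt_lim_comp_2d f (fun z => r * rot_fst theta z) (fun z => r * rot_snd theta z)); [exact Hf | |];
    apply is_derive_Reals; now apply is_derive_scal.
Qed.

Lemma continuity_2d_pt_frame (theta : plane) (r t : R) :
  continuity_2d_pt (fun _ t => rot_fst theta t) r t /\
  continuity_2d_pt (fun _ t => rot_snd theta t) r t.
Proof.
  destruct (is_derive_frame theta t) as [H1 H2].
  apply is_derive_Reals in H1. apply is_derive_Reals in H2.
  split.
  - apply (continuity_1d_2d_pt_comp (rot_fst theta) (fun _ t => t)).
    + apply derivable_continuous_pt. eexists. exact H1.
    + apply continuity_2d_pt_id2.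
  - apply (continuity_1d_2d_pt_comp (rot_snd theta) (fun _ t => t)).
    + apply derivable_continuous_pt. eexists. exact H2.
    + apply continuity_2d_pt_id2.
Qed.

Lemma continuity_2d_pt_polar (theta : plane) (f : R -> R -> R) (r t : R) :
  continuity_2d_pt f (r * rot_fst theta t) (r * rot_snd theta t) ->
  continuity_2d_pt (fun r t => f (r * rot_fst theta t) (r * rot_snd theta t)) r t.
Proof.
  intros Hf. destruct (continuity_2d_pt_frame theta r t) as [H1 H2].
  apply (continuity_2d_pt_comp f (fun r t => r * rot_fst theta t)
    (fun r t => r * rot_snd theta t)); [exact Hf | |];
    (apply continuity_2d_pt_mult; [apply continuity_2d_pt_id1 | assumption]).
Qed.

(* [C^2] regularity enters only through differentiability of [f], [f_x], [f_y]:
   the two mixed derivatives cancel between [u_rr] and [u_tt] without being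
   known to coincide. *)
Lemma polar_helmholtz_of_cartesian (theta : plane) (kappa M : R) (f : R -> R -> R) :
  unit_vec theta -> 0 <= M ->
  (forall x y, M ^ 2 < x ^ 2 + y ^ 2 ->
     ex_diff_n f 2 x y /\ laplacian2 f x y = - kappa ^ 2 * f x y) ->
  polar_helmholtz kappa M (fun r t => f (r * rot_fst theta t) (r * rot_snd theta t)).
Proof.
  intros Hth HM Hf.
  set (fx := fun u v => Derive (fun z => f z v) u).
  set (fy := fun u v => Derive (fun z => f u z) v).
  set (fxx := fun u v => Derive (fun z => fx z v) u).
  set (fxy := fun u v => Derive (fun z => fx u z) v).
  set (fyx := fun u v => Derive (fun z => fy z v) u).
  set (fyy := fun u v => Derive (fun z => fy u z) v).
  assert (Hout : forall r t, M < r -> M ^ 2 < (r * rot_fst theta t) ^ 2 + (r * rot_snd theta t) ^ 2).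
  { intros r t Hr. replace ((r * rot_fst theta t) ^ 2 + (r * rot_snd theta t) ^ 2) with
      (r ^ 2 * (rot_fst theta t ^ 2 + rot_snd theta t ^ 2)) by ring. rewrite frame_norm by exact Hth. nra. }
  assert (Hloc : forall r t, M < r ->
    locally_2d (fun x y => M ^ 2 < x ^ 2 + y ^ 2) (r * rot_fst theta t) (r * rot_snd theta t)).
  { intros r t Hr. now apply locally_2d_outside_disc, Hout. }
  assert (Df : forall r t, M < r -> differentiable_pt_lim f (r * rot_fst theta t) (r * rot_snd theta t)
     (fx (r * rot_fst theta t) (r * rot_snd theta t)) (fy (r * rot_fst theta t) (r * rot_snd theta t))).
  { intros r t Hr. apply ex_diff_1_differentiable.
    apply locally_2d_impl with (2 := Hloc r t Hr). apply locally_2d_forall.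
    intros x y H. apply ex_diff_n_m with 2%nat; [lia | now apply Hf]. }
  assert (Dfx : forall r t, M < r -> differentiable_pt_lim fx (r * rot_fst theta t) (r * rot_snd theta t)
     (fxx (r * rot_fst theta t) (r * rot_snd theta t)) (fxy (r * rot_fst theta t) (r * rot_snd theta t))).
  { intros r t Hr. apply ex_diff_1_differentiable.
    apply locally_2d_impl with (2 := Hloc r t Hr). apply locally_2d_forall.
    intros x y H. apply ex_diff_n_deriv_aux1. now apply Hf. }
  assert (Dfy : forall r t, M < r -> differentiable_pt_lim fy (r * rot_fst theta t) (r * rot_snd theta t)
     (fyx (r * rot_fst theta t) (r * rot_snd theta t)) (fyy (r * rot_fst theta t) (r * rot_snd theta t))).
  { intros r t Hr. apply ex_diff_1_differentiable.
    apply locally_2d_impl with (2 := Hloc r t Hr). apply locally_2d_forall.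
    intros x y H. apply ex_diff_n_deriv_aux2. now apply Hf. }
  set (ur := fun r t => fx (r * rot_fst theta t) (r * rot_snd theta t) * rot_fst theta t + fy (r * rot_fst theta t) (r * rot_snd theta t) * rot_snd theta t).
  set (urr := fun r t =>
    (fxx (r * rot_fst theta t) (r * rot_snd theta t) * rot_fst theta t + fxy (r * rot_fst theta t) (r * rot_snd theta t) * rot_snd theta t) * rot_fst theta t
    + (fyx (r * rot_fst theta t) (r * rot_snd theta t) * rot_fst theta t + fyy (r * rot_fst theta t) (r * rot_snd theta t) * rot_snd theta t) * rot_snd theta t).
  set (ut := fun r t =>
    r * (fy (r * rot_fst theta t) (r * rot_snd theta t) * rot_fst theta t - fx (r * rot_fst theta t) (r * rot_snd theta t) * rot_snd theta t)).
  set (utt := fun r t => - r * ur r t + r * r *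
    ((fyy (r * rot_fst theta t) (r * rot_snd theta t) * rot_fst theta t - fyx (r * rot_fst theta t) (r * rot_snd theta t) * rot_snd theta t) * rot_fst theta t
     - (fxy (r * rot_fst theta t) (r * rot_snd theta t) * rot_fst theta t - fxx (r * rot_fst theta t) (r * rot_snd theta t) * rot_snd theta t) * rot_snd theta t)).
  exists ur, urr, ut, utt. intros r t Hr.
  destruct (Hf _ _ (Hout r t Hr)) as [(_ & _ & _ & Cx & Cy) HL].
  destruct Cx as (Cfx & _ & _ & [Cfxx _] & [Cfxy _]).
  destruct Cy as (Cfy & _ & _ & [Cfyx _] & [Cfyy _]).
  apply continuity_2d_pt_polar in Cfx, Cfy, Cfxx, Cfxy, Cfyx, Cfyy.
  destruct (continuity_2d_pt_frame theta r t) as [Cco Csi].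
  assert (Cur : continuity_2d_pt ur r t).
  { unfold ur. apply continuity_2d_pt_plus; apply continuity_2d_pt_mult; auto. }
  refine (conj _ (conj _ (conj _ (conj _ (conj Cur (conj _ (conj _ _))))))).
  - now apply (is_derive_radial theta f), Df.
  - unfold ur, urr.
    apply (is_derive_plus (fun z => fx (z * rot_fst theta t) (z * rot_snd theta t) * rot_fst theta t)).
    + rewrite Rmult_comm.
      apply is_derive_ext with (fun z => rot_fst theta t * fx (z * rot_fst theta t) (z * rot_snd theta t)).
      { intros; apply Rmult_comm. }
      now apply is_derive_scal, (is_derive_radial theta fx), Dfx.
    + rewrite Rmult_comm.
      apply is_derive_ext with (fun z => rot_snd theta t * fy (z * rot_fst theta t) (z * rot_snd theta t)).
      { intros; apply Rmult_comm. }
      now apply is_derive_scal, (is_derive_radial theta fy), Dfy.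
  - now apply (is_derive_angular theta f), Df.
  - pose proof (is_derive_angular theta fx r t _ _ (Dfx r t Hr)) as D1.
    pose proof (is_derive_angular theta fy r t _ _ (Dfy r t Hr)) as D2.
    destruct (is_derive_frame theta t) as [D3 D4].
    pose proof (is_derive_scal _ _ r _ (is_derive_minus _ _ _ _ _
       (is_derive_mult _ _ _ _ _ D2 D3 Rmult_comm)
       (is_derive_mult _ _ _ _ _ D1 D4 Rmult_comm))) as D5.
    match type of D5 with is_derive ?f _ ?l =>
      match goal with |- is_derive ?g _ ?m => replace m with l; [exact D5|] end end.
    unfold utt, ur, minus, plus, opp, mult, scal; simpl; unfold mult; simpl. ring.
  - unfold urr. apply continuity_2d_pt_plus; apply continuity_2d_pt_mult; auto;
    apply continuity_2d_pt_plus; apply continuity_2d_pt_mult; auto.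
  - apply continuity_2d_pt_slice. unfold utt.
    assert (Cr : continuity_2d_pt (fun u _ => u) r t) by apply continuity_2d_pt_id1.
    apply continuity_2d_pt_plus; apply continuity_2d_pt_mult; auto.
    + now apply continuity_2d_pt_opp.
    + now apply continuity_2d_pt_mult.
    + apply continuity_2d_pt_minus; apply continuity_2d_pt_mult; auto;
      apply continuity_2d_pt_minus; apply continuity_2d_pt_mult; auto.
  - change (laplacian2 f (r * rot_fst theta t) (r * rot_snd theta t)) with
      (fxx (r * rot_fst theta t) (r * rot_snd theta t) + fyy (r * rot_fst theta t) (r * rot_snd theta t)) in HL.
    (* The combination [urr + ur / r + utt / r ^ 2] is the Laplacian times the squared norm of the
       frame vector. Inserting the same factor on [f] makes the two sides agree as rational
       expressions. *)
    replace (f (r * rot_fst theta t) (r * rot_snd theta t)) with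
      (f (r * rot_fst theta t) (r * rot_snd theta t) * (rot_fst theta t ^ 2 + rot_snd theta t ^ 2)) by (rewrite frame_norm by exact Hth; ring).
    replace (kappa ^ 2 * (f (r * rot_fst theta t) (r * rot_snd theta t) * (rot_fst theta t ^ 2 + rot_snd theta t ^ 2))) with
      (- (fxx (r * rot_fst theta t) (r * rot_snd theta t) + fyy (r * rot_fst theta t) (r * rot_snd theta t))
        * (rot_fst theta t ^ 2 + rot_snd theta t ^ 2)) by (rewrite HL; ring).
    unfold utt, urr. field. lra.
Qed.

(** * Norms, directions and the far-field expansion along rotated rays *)

Lemma enorm_ge_0 (x : plane) : 0 <= enorm x.
Proof. apply sqrt_pos. Qed.

Lemma enorm_sqr (x : plane) : enorm x ^ 2 = fst x ^ 2 + snd x ^ 2.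
Proof.
  unfold enorm. rewrite <- Rsqr_pow2, Rsqr_sqrt; unfold dot; [ring | nra].
Qed.

Lemma enorm_pscal (r : R) (x : plane) : 0 <= r -> enorm (pscal r x) = r * enorm x.
Proof.
  intros Hr. unfold enorm.
  replace (dot (pscal r x) (pscal r x)) with (r * r * dot x x)
    by (unfold dot, pscal; simpl; ring).
  rewrite sqrt_mult_alt, sqrt_square by nra. reflexivity.
Qed.

Lemma direction_pscal (r : R) (x : plane) : 0 < r -> unit_vec x -> direction (pscal r x) = x.
Proof.
  intros Hr Hx. unfold direction. rewrite enorm_pscal, Hx by lra.
  destruct x as [a b]. unfold pscal; simpl. f_equal; field; lra.
Qed.

Lemma enorm_open (M : R) (x : plane) :
  M < enorm x -> locally x (fun y : plane => M < enorm y).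
Proof.
  intros H. destruct (Rlt_le_dec M 0) as [HM|HM].
  { apply filter_forall. intros y. pose proof (enorm_ge_0 y). lra. }
  assert (Hx : M ^ 2 < fst x ^ 2 + snd x ^ 2).
  { rewrite <- enorm_sqr. nra. }
  pose proof (locally_2d_outside_disc _ _ _ Hx) as L. apply locally_2d_locally in L.
  destruct x as [a b]. apply filter_imp with (2 := L). intros y Hy.
  rewrite <- enorm_sqr in Hy. pose proof (enorm_ge_0 y).
  destruct (Rle_lt_dec (enorm y) M); [nra | assumption].
Qed.

(** The set of points of norm greater than [M] is a neighbourhood of each of its points and misses
    [Omega], so none of them is a boundary point. *)
Lemma exterior_of_bounded (Omega : plane -> Prop) :
  bounded_set Omega ->
  exists M, 1 <= M /\ forall x, M < enorm x -> exterior Omega x.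
Proof.
  intros [M HM]. exists (Rmax 1 M). split; [apply Rmax_l|]. intros x Hx.
  pose proof (Rmax_r 1 M). intros [H1 | [H1 _]].
  - specialize (HM x H1). lra.
  - destruct (H1 (fun y => M < enorm y)) as (y & Hy & Hy').
    + apply enorm_open. lra.
    + specialize (HM y Hy'). lra.
Qed.

Lemma Rpower_three_halves (r : R) : 0 < r -> Rpower r (3 / 2) = r * sqrt r.
Proof.
  intros Hr. replace (3 / 2) with (1 + / 2) by field.
  now rewrite Rpower_plus, Rpower_1, Rpower_sqrt.
Qed.

Definition rotate (theta : plane) (t : R) : plane := (rot_fst theta t, rot_snd theta t).

Lemma unit_vec_rotate (theta : plane) (t : R) : unit_vec theta -> unit_vec (rotate theta t).
Proof.
  intros H. unfold unit_vec, enorm.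
  replace (dot (rotate theta t) (rotate theta t)) with
    (rot_fst theta t ^ 2 + rot_snd theta t ^ 2) by (unfold dot, rotate; simpl; ring).
  rewrite frame_norm by exact H. apply sqrt_1.
Qed.

(** Multiplying the remainder [w] by [sqrt r e^{-i kappa r}] lowers its order from [r^{-3/2}] to
    [1 / r]. The factor 2 comes from bounding each component of [w] by [Cmod w]. *)
Lemma amplitude_far_field (kappa r K : R) (psi f : C) :
  0 < r ->
  Cmod (psi - cexpi (kappa * r) / RtoC (sqrt r) * f)%C <= K / Rpower r (3 / 2) ->
  Rabs (amplitude kappa (fun _ => Re psi) (fun _ => Im psi) r - Re f) <= 2 * K / r /\
  Rabs (amplitude kappa (fun _ => Im psi) (fun _ => - Re psi) r - Im f) <= 2 * K / r.
Proof.
  intros Hr H. set (w := (psi - cexpi (kappa * r) / RtoC (sqrt r) * f)%C) in H.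
  assert (Hs : 0 < sqrt r) by now apply sqrt_lt_R0.
  assert (Es : sqrt r * sqrt r = r) by (apply sqrt_sqrt; lra).
  rewrite Rpower_three_halves in H by exact Hr.
  assert (Hw : sqrt r * Cmod w <= K / r).
  { replace (K / r) with (sqrt r * (K / (r * sqrt r))) by (field; lra).
    apply Rmult_le_compat_l; lra. }
  pose proof (Rmax_Cmod w) as Hmax.
  pose proof (Rmax_l (Rabs (fst w)) (Rabs (snd w))).
  pose proof (Rmax_r (Rabs (fst w)) (Rabs (snd w))).
  assert (Ew : fst w = Re psi - (cos (kappa * r) * Re f - sin (kappa * r) * Im f) / sqrt r
            /\ snd w = Im psi - (sin (kappa * r) * Re f + cos (kappa * r) * Im f) / sqrt r).
  { unfold w, cexpi, Re, Im. destruct psi as [u v], f as [F G]. simpl. split; field; lra. }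
  destruct Ew as [E1 E2].
  assert (Hcs : cos (kappa * r) * cos (kappa * r) = 1 - sin (kappa * r) * sin (kappa * r)).
  { pose proof (sin2_cos2 (kappa * r)) as T. unfold Rsqr in T. lra. }
  pose proof (COS_bound (kappa * r)). pose proof (SIN_bound (kappa * r)).
  assert (Comb : forall p q : R, -1 <= p <= 1 -> -1 <= q <= 1 ->
    Rabs (sqrt r * (fst w * p + snd w * q)) <= 2 * K / r).
  { intros p q Hp Hq. rewrite Rabs_mult, (Rabs_pos_eq (sqrt r)) by lra.
    replace (2 * K / r) with (2 * (K / r)) by (field; lra).
    apply Rle_trans with (sqrt r * (2 * Cmod w)); [|lra].
    apply Rmult_le_compat_l; [lra|].
    eapply Rle_trans; [apply Rabs_triang|]. rewrite !Rabs_mult.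
    assert (Rabs p <= 1) by (apply Rabs_le; lra).
    assert (Rabs q <= 1) by (apply Rabs_le; lra).
    pose proof (Rabs_pos p). pose proof (Rabs_pos q).
    pose proof (Rabs_pos (fst w)). pose proof (Rabs_pos (snd w)). nra. }
  split.
  - replace (_ - Re f) with (sqrt r * (fst w * cos (kappa * r) + snd w * sin (kappa * r)));
      [apply Comb; lra|].
    unfold amplitude. rewrite E1, E2. field_simplify; [|lra..].
    replace (cos (kappa * r) ^ 2) with (1 - sin (kappa * r) * sin (kappa * r)) by (rewrite <- Hcs; ring).
    ring.
  - replace (_ - Im f) with (sqrt r * (fst w * - sin (kappa * r) + snd w * cos (kappa * r)));
      [apply Comb; lra|].
    unfold amplitude. rewrite E1, E2. field_simplify; [|lra..].
    replace (cos (kappa * r) ^ 2) with (1 - sin (kappa * r) * sin (kappa * r)) by (rewrite <- Hcs; ring).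
    ring.
Qed.

Lemma lipschitz_of_polar_far_field (kappa M C : R) (u v : R -> R -> R) (F G : R -> R) :
  0 <= kappa -> 1 <= M ->
  polar_helmholtz kappa M u -> polar_helmholtz kappa M v ->
  (forall r t, M < r ->
     Rabs (amplitude kappa (fun r => u r t) (fun r => v r t) r - F t) <= C / r) ->
  (forall r t, M < r ->
     Rabs (amplitude kappa (fun r => v r t) (fun r => - u r t) r - G t) <= C / r) ->
  exists L, 0 <= L /\ forall t, Rabs t <= 1 -> Rabs (F t - F 0) <= L * Rabs t.
Proof.
  intros Hk HM Hu Hv HF HG.
  set (r := M + 1). assert (Hr : M < r) by (unfold r; lra).
  set (a := fun t => amplitude kappa (fun r => u r t) (fun r => v r t) r).
  assert (Ca : forall t, continuity_pt (fun t => Rabs (a t)) t).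
  { intros t. apply continuity_pt_filterlim.
    apply (continuous_comp a Rabs); [|apply continuous_Rabs].
    unfold a, amplitude.
    apply (continuous_mult (fun _ => sqrt r)); [apply continuous_const|].
    apply (continuous_plus (fun t => u r t * cos (kappa * r))).
    - apply (continuous_mult (u r) (fun _ => cos (kappa * r))); [|apply continuous_const].
      now apply (polar_helmholtz_continuous kappa M).
    - apply (continuous_mult (v r) (fun _ => sin (kappa * r))); [|apply continuous_const].
      now apply (polar_helmholtz_continuous kappa M). }
  destruct (continuity_ab_maj (fun t => Rabs (a t)) (-1) 1 ltac:(lra) (fun c _ => Ca c))
    as (t0 & Ht0 & _).
  set (B := Rabs (a t0) + C / r).
  assert (HB : forall t, Rabs (t - 0) <= 1 -> Rabs (F t) <= B).
  { intros t Ht. rewrite Rminus_0_r in Ht. apply Rabs_le_between in Ht.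
    specialize (Ht0 t ltac:(lra)). pose proof (HF r t Hr) as H. fold (a t) in H.
    replace (F t) with (a t + - (a t - F t)) by ring.
    eapply Rle_trans; [apply Rabs_triang|]. rewrite Rabs_Ropp. unfold B. lra. }
  assert (HC : 0 <= C).
  { pose proof (HF r 0 Hr) as A.
    pose proof (Rabs_pos (amplitude kappa (fun r => u r 0) (fun r => v r 0) r - F 0)).
    replace C with (C / r * r) by (field; lra). apply Rmult_le_pos; lra. }
  assert (HB0 : 0 <= B).
  { eapply Rle_trans; [apply Rabs_pos | apply (HB 0)]. rewrite Rminus_diag, Rabs_R0. lra. }
  set (K := 72 * (1 + kappa) * C + C + B).
  assert (HK : 0 <= K).
  { unfold K. pose proof (Rmult_le_pos kappa C Hk HC). lra. }
  exists (4 * B + K). split; [lra|]. intros t Ht.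
  replace (Rabs t) with (Rabs (t - 0)) by (f_equal; ring).
  apply lipschitz_of_second_difference; [exact HK | exact HB | |].
  - intros x h Hh Hx.
    apply (far_field_second_difference kappa M C B x h u v F G); try assumption.
    intros s Hs. apply HB.
    replace (s - 0) with ((s - x) + (x - 0)) by ring.
    eapply Rle_trans; [apply Rabs_triang|]. lra.
  - now rewrite Rminus_0_r.
Qed.

Lemma polar_helmholtz_opp (kappa M : R) (u : R -> R -> R) :
  polar_helmholtz kappa M u -> polar_helmholtz kappa M (fun r t => - u r t).
Proof.
  intros (ur & urr & ut & utt & Hu).
  exists (fun r t => - ur r t), (fun r t => - urr r t),
    (fun r t => - ut r t), (fun r t => - utt r t).
  intros r t Hr. destruct (Hu r t Hr) as (H1 & H2 & H3 & H4 & H5 & H6 & H7 & H8).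
  refine (conj _ (conj _ (conj _ (conj _ (conj _ (conj _ (conj _ _))))))).
  - now apply (is_derive_opp (fun z => u z t)).
  - now apply (is_derive_opp (fun z => ur z t)).
  - now apply (is_derive_opp (u r)).
  - now apply (is_derive_opp (ut r)).
  - now apply continuity_2d_pt_opp.
  - now apply continuity_2d_pt_opp.
  - now apply (continuous_opp (utt r)).
  - rewrite H8. unfold Rdiv. ring.
Qed.

Lemma far_field_lipschitz (Omega : plane -> Prop) (kappa : R) (psi f : plane -> C)
    (theta : plane) :
  bounded_set Omega -> 0 <= kappa ->
  C2_on (exterior Omega) psi -> helmholtz kappa (exterior Omega) psi ->
  far_field_pattern kappa (exterior Omega) psi f -> unit_vec theta ->
  exists L, 0 <= L /\
    forall t, Rabs t <= 1 -> Cmod (f (rotate theta t) - f theta)%C <= L * Rabs t.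
Proof.
  intros Hb Hk HC2 HH (K & R0 & HC & HR0 & Hf) Hth.
  destruct (exterior_of_bounded Omega Hb) as (M0 & HM0 & Hext).
  set (M := Rmax M0 R0).
  assert (HMM : M0 <= M /\ R0 <= M) by (unfold M; split; [apply Rmax_l | apply Rmax_r]).
  destruct HMM as [HM1 HM2]. clearbody M.
  set (pt := fun r t => pscal r (rotate theta t)).
  assert (Hpt : forall r t, M < r -> enorm (pt r t) = r).
  { intros r t Hr. unfold pt. rewrite enorm_pscal, unit_vec_rotate by (assumption || lra). ring. }
  assert (Hout : forall x y, M ^ 2 < x ^ 2 + y ^ 2 -> exterior Omega (x, y)).
  { intros x y H. apply Hext. pose proof (enorm_ge_0 (x, y)).
    pose proof (enorm_sqr (x, y)) as E. simpl in E.
    destruct (Rle_lt_dec (enorm (x, y)) M0); [nra | assumption]. }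
  assert (Pu : polar_helmholtz kappa M (fun r t => Re (psi (pt r t)))).
  { apply (polar_helmholtz_of_cartesian theta kappa M (re2 psi)); [exact Hth | lra |].
    intros x y H. specialize (Hout x y H). split; [now apply (HC2 (x, y))|].
    pose proof (f_equal fst (HH (x, y) Hout)) as E. simpl in E.
    unfold re2 at 2. unfold Re. simpl in *. lra. }
  assert (Pv : polar_helmholtz kappa M (fun r t => Im (psi (pt r t)))).
  { apply (polar_helmholtz_of_cartesian theta kappa M (im2 psi)); [exact Hth | lra |].
    intros x y H. specialize (Hout x y H). split; [now apply (HC2 (x, y))|].
    pose proof (f_equal snd (HH (x, y) Hout)) as E. simpl in E.
    unfold im2 at 2. unfold Im. simpl in *. lra. }
  assert (Hamp : forall r t, M < r ->
    Rabs (amplitude kappa (fun r => Re (psi (pt r t))) (fun r => Im (psi (pt r t))) r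
          - Re (f (rotate theta t))) <= 2 * K / r /\
    Rabs (amplitude kappa (fun r => Im (psi (pt r t))) (fun r => - Re (psi (pt r t))) r
          - Im (f (rotate theta t))) <= 2 * K / r).
  { intros r t Hr. apply (amplitude_far_field kappa r K (psi (pt r t)) (f (rotate theta t))).
    - lra.
    - specialize (Hf (pt r t)). unfold outgoing_term in Hf. rewrite Hpt in Hf by exact Hr.
      unfold pt in Hf at 3. rewrite direction_pscal in Hf;
        [|lra | now apply unit_vec_rotate].
      apply Hf; [apply Hext; rewrite Hpt; lra | lra]. }
  destruct (lipschitz_of_polar_far_field kappa M (2 * K) _ _
    (fun t => Re (f (rotate theta t))) (fun t => Im (f (rotate theta t)))
    Hk ltac:(lra) Pu Pv (fun r t Hr => proj1 (Hamp r t Hr)) (fun r t Hr => proj2 (Hamp r t Hr)))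
    as (L1 & HL1 & HF).
  (* Multiplication by [- i] sends [(u, v)] to [(v, - u)] and turns the imaginary part of the
     pattern into a real part, with [- Re] as its companion. *)
  destruct (lipschitz_of_polar_far_field kappa M (2 * K) _ _
    (fun t => Im (f (rotate theta t))) (fun t => - Re (f (rotate theta t)))
    Hk ltac:(lra) Pv (polar_helmholtz_opp _ _ _ Pu)
    (fun r t Hr => proj2 (Hamp r t Hr))) as (L2 & HL2 & HG).
  { intros r t Hr. destruct (Hamp r t Hr) as [H _]. rewrite <- Rabs_Ropp in H.
    replace (amplitude _ _ _ r - - Re (f (rotate theta t))) with
      (- (amplitude kappa (fun r => Re (psi (pt r t))) (fun r => Im (psi (pt r t))) r
          - Re (f (rotate theta t)))); [exact H|].
    unfold amplitude. ring. }
  assert (E0 : rotate theta 0 = theta).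
  { unfold rotate, rot_fst, rot_snd. rewrite cos_0, sin_0. destruct theta as [a b]; simpl.
    f_equal; ring. }
  exists (sqrt 2 * (L1 + L2)). split; [apply Rmult_le_pos; [apply sqrt_pos | lra]|].
  intros t Ht. specialize (HF t Ht). specialize (HG t Ht). simpl in HF, HG.
  rewrite E0 in HF, HG. pose proof (Rabs_pos t).
  eapply Rle_trans; [apply Cmod_2Rmax|].
  rewrite Rmult_assoc. apply Rmult_le_compat_l; [apply sqrt_pos|].
  destruct (f (rotate theta t)) as [F1 G1], (f theta) as [F0 G0]. simpl in *.
  apply Rmax_lub.
  - apply Rle_trans with (L1 * Rabs t); [exact HF | nra].
  - apply Rle_trans with (L2 * Rabs t); [exact HG | nra].
Qed.

(** * Recovering the far field from two intensities *)

(** The error is shared in the proportion [a : b], which keeps the constant [K]. This turns an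
    estimate by a sum into separate error terms that can be placed over different powers of [D]. *)
Lemma Cmod_split (z : C) (K a b : R) :
  0 <= a -> 0 <= b -> Cmod z <= K * (a + b) ->
  exists u v : C, z = (u + v)%C /\ Cmod u <= K * a /\ Cmod v <= K * b.
Proof.
  intros Ha Hb Hz. destruct (Req_dec (a + b) 0) as [H|H].
  - exists z, (RtoC 0). rewrite Cmod_0.
    assert (a = 0) by lra. assert (b = 0) by lra. subst.
    repeat split; [ring | lra | lra].
  - assert (Hw : forall c, 0 <= c -> Cmod (RtoC (c / (a + b)) * z) <= K * c).
    { intros c Hc. rewrite Cmod_mult, Cmod_R, Rabs_pos_eq.
      - replace (K * c) with (c / (a + b) * (K * (a + b))) by (field; exact H).
        apply Rmult_le_compat_l; [|exact Hz].
        apply Rmult_le_pos; [lra | apply Rlt_le, Rinv_0_lt_compat; lra].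
      - apply Rmult_le_pos; [lra | apply Rlt_le, Rinv_0_lt_compat; lra]. }
    exists (RtoC (a / (a + b)) * z)%C, (RtoC (b / (a + b)) * z)%C.
    repeat split; auto.
    rewrite <- Cmult_plus_distr_r, <- RtoC_plus.
    replace (a / (a + b) + b / (a + b)) with 1 by (field; exact H). ring.
Qed.

Lemma Cmod_triangle_minus (u v : C) : Cmod (u - v) <= Cmod u + Cmod v.
Proof. eapply Rle_trans; [apply Cmod_triangle|]. rewrite Cmod_opp. lra. Qed.

(** The bound avoids [Cmod u]: it is applied with [u = F], where only [f] and [D (F - f)] are under
    control. *)
Lemma Cmod_sqr_sub_le (u v : C) :
  Rabs (Cmod u ^ 2 - Cmod v ^ 2) <= Cmod (u - v) * (2 * Cmod v + Cmod (u - v)).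
Proof.
  assert (H1 : Cmod u <= Cmod v + Cmod (u - v)).
  { replace u with (v + (u - v))%C at 1 by ring. apply Cmod_triangle. }
  assert (H2 : Cmod v <= Cmod u + Cmod (u - v)).
  { replace v with (u - (u - v))%C at 1 by ring. apply Cmod_triangle_minus. }
  pose proof (Cmod_ge_0 u). pose proof (Cmod_ge_0 v). pose proof (Cmod_ge_0 (u - v)).
  apply Rabs_le. nra.
Qed.

Lemma Cmod_cexpi (t : R) : Cmod (cexpi t) = 1.
Proof.
  unfold Cmod, cexpi; simpl. rewrite !Rmult_1_r.
  pose proof (sin2_cos2 t) as T. unfold Rsqr in T.
  replace (cos t * cos t + sin t * sin t) with 1 by lra. apply sqrt_1.
Qed.

Lemma RtoC_2Re (z : C) : RtoC (2 * Re z) = (z + Cconj z)%C.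
Proof. destruct z as [a b]. unfold Cplus, Cconj, RtoC, Re; simpl. f_equal; ring. Qed.

Lemma phase_determinant (s t : R) :
  (cexpi t * Cconj (cexpi s) - cexpi s * Cconj (cexpi t))%C = (RtoC 2 * Ci * RtoC (sin (t - s)))%C.
Proof.
  rewrite sin_minus.
  unfold cexpi, Cconj, Cmult, Cminus, Cplus, Copp, RtoC, Ci; simpl. f_equal; ring.
Qed.

(* Each of [alpha], [beta] is a real-linear equation for [f], up to the term in
   [|f|^2]; the combination [q alpha - p beta] eliminates [Cconj f].  Replacing
   [|f|^2] by [|F|^2] costs [|F - f| / sqrt r], which is where [1 / D^3] enters. *)
Lemma two_point_inversion (B K : R) :
  0 <= B -> 0 <= K ->
  exists L, 0 < L /\
  forall (s t r delta alpha beta : R) (f : C),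
    let p := cexpi s in
    let q := cexpi t in
    let D := (RtoC 2 * Ci * RtoC (sin (t - s)))%C in
    let F := (/ D * (q * RtoC alpha - p * RtoC beta))%C in
    Cmod f <= B -> 1 <= r -> 0 <= delta <= 1 -> D <> RtoC 0 ->
    Rabs (alpha - (2 * Re (Cconj p * f)%C + Cmod f ^ 2 / sqrt r)) <= K * (1 / r) ->
    Rabs (beta - (2 * Re (Cconj q * f)%C + Cmod f ^ 2 / sqrt r)) <= K * (delta + 1 / r) ->
    exists e1 e2 e3 : C,
      Cmod e1 <= L * delta /\ Cmod e2 <= L * (1 / r) /\ Cmod e3 <= L * (delta / sqrt r) /\
      f = (F - / D * (q - p) * (RtoC (Cmod F ^ 2) / RtoC (sqrt r))
           + / D * e1 + / (D * D * D) * (e2 + e3))%C.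
Proof.
  intros HB HK.
  (* Chosen so that [D (F - f)] is at most [K1 * (1 / sqrt r + delta)]: the quadratic term gives
     [2 * B ^ 2], the two intensity errors at most [3 * K]. *)
  set (K1 := 2 * B ^ 2 + 3 * K).
  assert (HK1 : 0 <= K1) by (unfold K1; nra).
  exists (2 * (4 * B + 2 * K1) * K1 + 8 * K + 1).
  split; [nra|].
  intros s t r delta alpha beta f p q D F Hf Hr Hd HD Ha Hb.
  assert (Hp : Cmod p = 1) by apply Cmod_cexpi.
  assert (Hq : Cmod q = 1) by apply Cmod_cexpi.
  assert (HDpq : D = (q * Cconj p - p * Cconj q)%C) by (symmetry; apply phase_determinant).
  clearbody D.
  assert (HDle : Cmod D <= 2).
  { rewrite HDpq. eapply Rle_trans; [apply Cmod_triangle_minus|].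
    rewrite !Cmod_mult, !Cmod_conj, Hp, Hq. lra. }
  assert (Hs : 0 < sqrt r) by (apply sqrt_lt_R0; lra).
  assert (Hs1 : 1 <= sqrt r) by (rewrite <- sqrt_1; apply sqrt_le_1_alt; lra).
  assert (Es : sqrt r * sqrt r = r) by (apply sqrt_sqrt; lra).
  assert (HS : RtoC (sqrt r) <> RtoC 0) by (intros E; apply RtoC_inj in E; lra).
  assert (His : 0 <= 1 / sqrt r) by (apply Rlt_le, Rdiv_lt_0_compat; lra).
  assert (His1 : 1 / sqrt r <= 1).
  { apply Rmult_le_reg_r with (sqrt r); [lra|].
    replace (1 / sqrt r * sqrt r) with 1 by (field; lra). lra. }
  assert (Hir : 1 / r = 1 / sqrt r * (1 / sqrt r)).
  { rewrite <- Es at 1. field. lra. }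
  set (m := 1 / sqrt r) in *.
  set (epsa := alpha - (2 * Re (Cconj p * f)%C + Cmod f ^ 2 / sqrt r)) in *.
  set (epsb := beta - (2 * Re (Cconj q * f)%C + Cmod f ^ 2 / sqrt r)) in *.
  (* The part of size [delta] must stay over [D], as it is too large for the terms over [D^3]; the
     part of size [1 / r] joins those. *)
  destruct (Cmod_split (RtoC epsb) K delta (1 / r)) as (ez & er & Eb & Hez & Her).
  { lra. } { rewrite Hir. nra. } { now rewrite Cmod_R. }
  assert (EF : (D * F = D * f + (q - p) * (RtoC (Cmod f ^ 2) / RtoC (sqrt r))
                 + (q * RtoC epsa - p * (ez + er)))%C).
  { unfold F. rewrite <- Eb.
    assert (Ea' : alpha = 2 * Re (Cconj p * f)%C + Cmod f ^ 2 / sqrt r + epsa) by (unfold epsa; ring).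
    assert (Eb' : beta = 2 * Re (Cconj q * f)%C + Cmod f ^ 2 / sqrt r + epsb) by (unfold epsb; ring).
    rewrite Ea', Eb'. rewrite !RtoC_plus, !RtoC_2Re, !RtoC_div by lra.
    rewrite !Cmult_conj, !Cconj_conj.
    transitivity ((q * Cconj p - p * Cconj q) * f
      + (q - p) * (RtoC (Cmod f ^ 2) / RtoC (sqrt r)) + (q * RtoC epsa - p * RtoC epsb))%C.
    - field. split; assumption.
    - now rewrite <- HDpq. }
  (* All errors except [p * ez], brought over [D^3]. In [|F|^2 - |f|^2] one factor [D] pairs with
     [F - f] and the other with [2 |f| + |F - f|], so that only the bounded quantity [u] occurs. *)
  set (T := (D * D * ((q - p) * ((RtoC (Cmod F ^ 2) - RtoC (Cmod f ^ 2)) / RtoC (sqrt r))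
              - (q * RtoC epsa - p * er)))%C).
  assert (Hqp : Cmod (q - p) <= 2).
  { eapply Rle_trans; [apply Cmod_triangle_minus|]. lra. }
  assert (Hf2 : Cmod f ^ 2 <= B ^ 2) by (apply pow_incr; split; [apply Cmod_ge_0 | exact Hf]).
  set (u := Cmod (D * (F - f))%C).
  assert (Hu : u <= K1 * (m + delta)).
  { unfold u.
    replace (D * (F - f))%C with ((q - p) * (RtoC (Cmod f ^ 2) / RtoC (sqrt r))
                 + (q * RtoC epsa - p * (ez + er)))%C
      by (transitivity (D * F - D * f)%C; [rewrite EF; ring | ring]).
    eapply Rle_trans; [apply Cmod_triangle|].
    apply Rle_trans with (2 * (B ^ 2 * m) + (K * (1 / r) + (K * delta + K * (1 / r)))).
    - apply Rplus_le_compat.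
      + rewrite Cmod_mult, Cmod_div, !Cmod_R by exact HS.
        rewrite (Rabs_pos_eq (sqrt r)) by lra.
        rewrite Rabs_pos_eq by apply pow2_ge_0.
        replace (Cmod f ^ 2 / sqrt r) with (Cmod f ^ 2 * m) by (unfold m; field; lra).
        apply Rmult_le_compat; [apply Cmod_ge_0 | | exact Hqp |].
        * apply Rmult_le_pos; [apply pow2_ge_0 | exact His].
        * now apply Rmult_le_compat_r.
      + eapply Rle_trans; [apply Cmod_triangle_minus|].
        rewrite !Cmod_mult, Hp, Hq, !Rmult_1_l, Cmod_R.
        pose proof (Cmod_triangle ez er). lra.
    - rewrite Hir. unfold K1.
      assert (m * m <= m) by nra. nra. }
  assert (Hu0 : 0 <= u) by apply Cmod_ge_0.
  assert (HT : Cmod T <= (2 * (4 * B + 2 * K1) * K1 + 8 * K + 1) * (1 / r + delta / sqrt r)).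
  { replace (delta / sqrt r) with (delta * m) by (unfold m; field; lra).
    assert (Hdiff : Cmod (D * D) * Rabs (Cmod F ^ 2 - Cmod f ^ 2) <= u * (4 * B + u)).
    { apply Rle_trans with
        (Cmod (D * D) * (Cmod (F - f) * (2 * Cmod f + Cmod (F - f)))).
      - apply Rmult_le_compat_l; [apply Cmod_ge_0 | apply Cmod_sqr_sub_le].
      - replace (Cmod (D * D) * (Cmod (F - f) * (2 * Cmod f + Cmod (F - f))))
          with (u * (2 * (Cmod D * Cmod f) + u)) by (unfold u; rewrite !Cmod_mult; ring).
        apply Rmult_le_compat_l; [exact Hu0|].
        assert (Cmod D * Cmod f <= 2 * B)
          by (apply Rmult_le_compat; try apply Cmod_ge_0; assumption).
        lra. }
    unfold T. rewrite Cmod_mult.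
    apply Rle_trans with (Cmod (D * D) * (2 * (Rabs (Cmod F ^ 2 - Cmod f ^ 2) * m)
                             + 2 * K * (1 / r))).
    - apply Rmult_le_compat_l; [apply Cmod_ge_0|].
      eapply Rle_trans; [apply Cmod_triangle_minus|]. apply Rplus_le_compat.
      + rewrite Cmod_mult, <- RtoC_minus, Cmod_div, !Cmod_R by exact HS.
        rewrite (Rabs_pos_eq (sqrt r)) by lra.
        replace (Rabs (Cmod F ^ 2 - Cmod f ^ 2) / sqrt r) with
          (Rabs (Cmod F ^ 2 - Cmod f ^ 2) * m) by (unfold m; field; lra).
        apply Rmult_le_compat_r; [|exact Hqp].
        apply Rmult_le_pos; [apply Rabs_pos | exact His].
      + eapply Rle_trans; [apply Cmod_triangle_minus|].
        rewrite !Cmod_mult, Hp, Hq, !Rmult_1_l, Cmod_R. lra.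
    - assert (HDD : Cmod (D * D) <= 4).
      { rewrite Cmod_mult. pose proof (Cmod_ge_0 D). nra. }
      rewrite Hir.
      assert (A1 : u * (4 * B + u) <= K1 * (m + delta) * (4 * B + 2 * K1)).
      { apply Rmult_le_compat; try lra. nra. }
      assert (A2 : Cmod (D * D) * (2 * K * (m * m)) <= 8 * K * (m * m)).
      { apply Rle_trans with (4 * (2 * K * (m * m))); [|lra].
        apply Rmult_le_compat_r; [nra | exact HDD]. }
      assert (A3 : Cmod (D * D) * (2 * (Rabs (Cmod F ^ 2 - Cmod f ^ 2) * m))
              <= 2 * m * (K1 * (m + delta) * (4 * B + 2 * K1))).
      { replace (Cmod (D * D) * (2 * (Rabs (Cmod F ^ 2 - Cmod f ^ 2) * m)))
          with (2 * m * (Cmod (D * D) * Rabs (Cmod F ^ 2 - Cmod f ^ 2))) by ring.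
        apply Rmult_le_compat_l; lra. }
      assert (0 <= m * m) by nra. assert (0 <= delta * m) by nra.
      assert (0 <= K * (delta * m)) by (apply Rmult_le_pos; lra).
      nra. }
  destruct (Cmod_split T _ (1 / r) (delta / sqrt r)
     ltac:(rewrite Hir; nra) ltac:(apply Rmult_le_pos; [lra | now apply Rlt_le, Rinv_0_lt_compat])
     HT) as (e2 & e3 & ET & He2 & He3).
  exists (p * ez)%C, e2, e3. repeat split; [|exact He2 | exact He3 |].
  - rewrite Cmod_mult, Hp, Rmult_1_l. apply Rle_trans with (K * delta); [exact Hez|].
    apply Rmult_le_compat_r; [lra | nra].
  - rewrite <- ET. unfold T.
    assert (Ef : f = (F - / D * ((q - p) * (RtoC (Cmod f ^ 2) / RtoC (sqrt r))
                 + (q * RtoC epsa - p * (ez + er))))%C).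
    { transitivity (/ D * (D * F - ((q - p) * (RtoC (Cmod f ^ 2) / RtoC (sqrt r))
                 + (q * RtoC epsa - p * (ez + er)))))%C.
      - rewrite EF. field. split; assumption.
      - field. split; assumption. }
    rewrite Ef at 1. clearbody F. field. split; assumption.
Qed.

Lemma Cmod_sqr_add3 (a b c : C) :
  Cmod (a + (b + c))%C ^ 2 = Cmod a ^ 2 + Cmod b ^ 2 + Cmod c ^ 2
    + 2 * Re (Cconj a * b)%C + 2 * Re (Cconj a * c)%C + 2 * Re (Cconj b * c)%C.
Proof.
  rewrite !Cmod2_alt. destruct a, b, c. unfold Re, Im, Cconj, Cmult, Cplus; simpl. ring.
Qed.

Lemma Rabs_Re_conj_mul_le (a b : C) : Rabs (Re (Cconj a * b)%C) <= Cmod a * Cmod b.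
Proof.
  eapply Rle_trans; [apply re_le_Cmod|]. rewrite Cmod_mult, Cmod_conj. lra.
Qed.

(** Write [psi1 = g + w] with [g] the outgoing term. In the square of [psi0 + g + w], the term
    [|psi0|^2 = 1] cancels; the products of [w] with [psi0], with [g] and with itself account for
    [2 * K], [2 * B * K] and [K ^ 2]. *)
Lemma intensity_expansion (K B : R) (k x : plane) (psi1 : plane -> C) (f : C) :
  0 <= K -> Cmod f <= B -> 1 <= enorm x ->
  Cmod (psi1 x - cexpi (enorm k * enorm x) / RtoC (sqrt (enorm x)) * f)%C
    <= K / Rpower (enorm x) (3 / 2) ->
  Rabs (intensity_a psi1 x k
     - (2 * Re (Cconj (phase k x) * f)%C + Cmod f ^ 2 / sqrt (enorm x)))
    <= (2 * K + 2 * B * K + K ^ 2) * (1 / enorm x).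
Proof.
  intros HK Hf Hr H. unfold intensity_a, psi0, phase.
  set (r := enorm x) in *. set (th := enorm k * r) in *.
  set (w := (psi1 x - cexpi th / RtoC (sqrt r) * f)%C) in *.
  assert (Hs : 0 < sqrt r) by (apply sqrt_lt_R0; lra).
  assert (Hs1 : 1 <= sqrt r) by (rewrite <- sqrt_1; apply sqrt_le_1_alt; lra).
  assert (Es : sqrt r * sqrt r = r) by (apply sqrt_sqrt; lra).
  assert (HS : RtoC (sqrt r) <> RtoC 0) by (intros E; apply RtoC_inj in E; lra).
  rewrite Rpower_three_halves in H by lra.
  set (z := (cexpi th * f)%C).
  assert (Hz : Cmod z = Cmod f) by (unfold z; rewrite Cmod_mult, Cmod_cexpi; ring).
  set (g := (RtoC (/ sqrt r) * z)%C).
  assert (Hg : Cmod g = Cmod f * / sqrt r).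
  { unfold g. rewrite Cmod_mult, Hz, Cmod_R, Rabs_pos_eq; [ring|].
    now apply Rlt_le, Rinv_0_lt_compat. }
  assert (Epsi : psi1 x = (g + w)%C).
  { unfold w, g, z. rewrite RtoC_inv by lra. field. exact HS. }
  assert (Hmain : sqrt r * (2 * Re (Cconj (cexpi (dot k x)) * g)%C)
      = 2 * Re (Cconj (cexpi (dot k x - th)) * f)%C).
  { replace (Cconj (cexpi (dot k x)) * g)%C with
      (RtoC (/ sqrt r) * (Cconj (cexpi (dot k x - th)) * f))%C.
    - set (h := (Cconj (cexpi (dot k x - th)) * f)%C).
      replace (Re (RtoC (/ sqrt r) * h)%C) with (/ sqrt r * Re h)
        by (destruct h; unfold Re, Cmult, RtoC; simpl; ring).
      field. lra.
    - unfold g, z. unfold cexpi. rewrite cos_minus, sin_minus.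
      pose proof (sin2_cos2 th) as T. unfold Rsqr in T.
      destruct f as [F G]. unfold Cmult, Cconj, RtoC; simpl. f_equal; ring. }
  rewrite Epsi, Cmod_sqr_add3, Cmod_cexpi, Hg.
  replace (sqrt r * _ - _) with
    (sqrt r * (2 * Re (Cconj (cexpi (dot k x)) * w)%C)
     + sqrt r * (2 * Re (Cconj g * w)%C) + sqrt r * Cmod w ^ 2).
  2:{ rewrite <- Hmain. field. lra. }
  pose proof (Rabs_Re_conj_mul_le (cexpi (dot k x)) w) as B1. rewrite Cmod_cexpi in B1.
  pose proof (Rabs_Re_conj_mul_le g w) as B2. rewrite Hg in B2.
  pose proof (Cmod_ge_0 w) as Hw0. pose proof (Cmod_ge_0 f) as Hf0.
  assert (Hir : 0 < 1 / r) by (apply Rdiv_lt_0_compat; lra).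
  assert (Hw : sqrt r * Cmod w <= K * (1 / r)).
  { replace (K * (1 / r)) with (sqrt r * (K / (r * sqrt r))) by (field; lra).
    apply Rmult_le_compat_l; lra. }
  assert (Hir1 : 1 / r <= 1).
  { apply Rmult_le_reg_r with r; [lra|].
    replace (1 / r * r) with 1 by (field; lra). lra. }
  assert (Hw1 : Cmod w <= sqrt r * Cmod w) by nra.
  assert (Hi1 : / sqrt r <= 1) by (rewrite <- Rinv_1; apply Rinv_le_contravar; lra).
  assert (Hi0 : 0 < / sqrt r) by now apply Rinv_0_lt_compat.
  assert (C1 : Rabs (sqrt r * (2 * Re (Cconj (cexpi (dot k x)) * w)%C)) <= 2 * K * (1 / r)).
  { rewrite !Rabs_mult, (Rabs_pos_eq (sqrt r)), (Rabs_pos_eq 2) by lra. nra. }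
  assert (C2 : Rabs (sqrt r * (2 * Re (Cconj g * w)%C)) <= 2 * B * K * (1 / r)).
  { rewrite !Rabs_mult, (Rabs_pos_eq (sqrt r)), (Rabs_pos_eq 2) by lra.
    assert (Rabs (Re (Cconj g * w)%C) <= B * Cmod w).
    { eapply Rle_trans; [exact B2|]. apply Rmult_le_compat_r; [lra|].
      replace B with (B * 1) by ring. apply Rmult_le_compat; lra. }
    apply Rle_trans with (2 * B * (sqrt r * Cmod w)); [nra|].
    replace (2 * B * K * (1 / r)) with (2 * B * (K * (1 / r))) by ring.
    apply Rmult_le_compat_l; lra. }
  assert (C3 : Rabs (sqrt r * Cmod w ^ 2) <= K ^ 2 * (1 / r)).
  { rewrite Rabs_pos_eq by (apply Rmult_le_pos; [lra | apply pow2_ge_0]).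
    assert (Cmod w <= K) by nra.
    replace (sqrt r * Cmod w ^ 2) with (sqrt r * Cmod w * Cmod w) by ring.
    apply Rle_trans with (K * (1 / r) * K); [|right; ring].
    apply Rmult_le_compat; nra. }
  eapply Rle_trans; [apply Rabs_triang|].
  eapply Rle_trans; [apply Rplus_le_compat_r, Rabs_triang|]. lra.
Qed.

(** * Comparison of the two points on the line *)

Lemma Rabs_atan_le (z : R) : Rabs (atan z) <= Rabs z.
Proof.
  assert (Hpos : forall z, 0 < z -> 0 <= atan z <= z).
  { intros y Hy. split.
    - left. rewrite <- atan_0. now apply atan_increasing.
    - destruct (MVT_is_derive atan (fun x => / (1 + x ^ 2)) 0 y Hy) as (c & _ & E).
      + intros x _. auto_derive; [trivial|]. field. nra.
      + rewrite atan_0, !Rminus_0_r in E. rewrite E.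
        assert (/ (1 + c ^ 2) <= 1).
        { rewrite <- Rinv_1. apply Rinv_le_contravar; nra. }
        nra. }
  destruct (Rtotal_order z 0) as [H | [-> | H]].
  - specialize (Hpos (- z) ltac:(lra)). rewrite atan_opp in Hpos.
    rewrite !Rabs_left1 by lra. lra.
  - rewrite atan_0. lra.
  - specialize (Hpos z H). rewrite !Rabs_pos_eq by lra. lra.
Qed.

Lemma shifted_direction (theta zeta : plane) (r : R) :
  unit_vec theta -> 0 < r -> 2 * enorm zeta <= r ->
  Rabs (enorm (padd (pscal r theta) zeta) - r) <= enorm zeta /\
  exists t, Rabs t <= 2 * (enorm zeta / r) /\
    direction (padd (pscal r theta) zeta) = rotate theta t.
Proof.
  intros Hth Hr Hz. set (y := padd (pscal r theta) zeta).
  (* The coordinates of [y] in the frame [(theta, perp theta)]. As [A >= r / 2 > 0], the angle from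
     [theta] to [y] is [atan (Bn / A)], and the factor 2 in the bound on [t] comes from this
     [r / 2]. *)
  set (A := r + dot zeta theta). set (Bn := dot zeta (perp theta)).
  pose proof (unit_vec_dot theta Hth) as Hn.
  pose proof (enorm_sqr zeta) as Ez. pose proof (enorm_sqr y) as Ey.
  pose proof (enorm_ge_0 zeta) as Hz0. pose proof (enorm_ge_0 y) as Hy0.
  assert (Pyth : dot zeta theta ^ 2 + Bn ^ 2 = enorm zeta ^ 2).
  { rewrite Ez. transitivity (dot theta theta * (fst zeta ^ 2 + snd zeta ^ 2)).
    - unfold Bn, dot, perp; simpl. ring.
    - rewrite Hn. ring. }
  assert (Pythy : A ^ 2 + Bn ^ 2 = enorm y ^ 2).
  { unfold A. replace ((r + dot zeta theta) ^ 2 + Bn ^ 2) with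
      (r ^ 2 + 2 * r * dot zeta theta + (dot zeta theta ^ 2 + Bn ^ 2)) by ring.
    rewrite Pyth, Ez, Ey. unfold y, padd, pscal; simpl.
    replace (r * (r * 1)) with (r * r * dot theta theta) by (rewrite Hn; ring).
    unfold dot. ring. }
  assert (H1 : Rabs (dot zeta theta) <= enorm zeta) by (apply Rabs_le; nra).
  assert (H2 : Rabs Bn <= enorm zeta) by (apply Rabs_le; nra).
  apply Rabs_le_between in H1.
  assert (HA : r / 2 <= A) by (unfold A; lra).
  split.
  { apply Rabs_le. unfold A in Pythy. split; nra. }
  exists (atan (Bn / A)). split.
  - eapply Rle_trans; [apply Rabs_atan_le|]. unfold Rdiv at 1.
    rewrite Rabs_mult, (Rabs_pos_eq (/ A)) by (apply Rlt_le, Rinv_0_lt_compat; lra).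
    replace (2 * (enorm zeta / r)) with (enorm zeta * / (r / 2)) by (field; lra).
    apply Rmult_le_compat; [apply Rabs_pos | apply Rlt_le, Rinv_0_lt_compat; lra | exact H2 |].
    apply Rinv_le_contravar; lra.
  - assert (Hy : enorm y = A * sqrt (1 + (Bn / A)²)).
    { rewrite <- (sqrt_pow2 (enorm y)) by exact Hy0. rewrite <- Pythy.
      replace (A ^ 2 + Bn ^ 2) with (A ^ 2 * (1 + (Bn / A)²)) by (unfold Rsqr; field; lra).
      rewrite sqrt_mult_alt by apply pow2_ge_0. rewrite sqrt_pow2 by lra. reflexivity. }
    assert (Hq : 0 < sqrt (1 + (Bn / A)²)).
    { apply sqrt_lt_R0. pose proof (Rle_0_sqr (Bn / A)). lra. }
    assert (Hcos : cos (atan (Bn / A)) = A * / enorm y).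
    { rewrite cos_atan, Hy. field. split; lra. }
    assert (Hsin : sin (atan (Bn / A)) = Bn * / enorm y).
    { rewrite sin_atan, Hy. field. split; lra. }
    unfold direction, rotate, rot_fst, rot_snd, pscal. rewrite Hcos, Hsin.
    assert (E1 : fst y = fst theta * A - snd theta * Bn).
    { transitivity (fst theta * r + dot theta theta * fst zeta).
      - rewrite Hn. unfold y, padd, pscal; simpl. ring.
      - unfold A, Bn, dot, perp; simpl. ring. }
    assert (E2 : snd y = snd theta * A + fst theta * Bn).
    { transitivity (snd theta * r + dot theta theta * snd zeta).
      - rewrite Hn. unfold y, padd, pscal; simpl. ring.
      - unfold A, Bn, dot, perp; simpl. ring. }
    rewrite E1, E2. f_equal; ring.
Qed.

Lemma inv_sqrt_sub_le (r r' d : R) :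
  1 <= r -> 1 <= r' -> Rabs (r' - r) <= d -> Rabs (/ sqrt r' - / sqrt r) <= d / r.
Proof.
  intros Hr Hr' Hd.
  assert (Hs : 1 <= sqrt r) by (rewrite <- sqrt_1; apply sqrt_le_1_alt; lra).
  assert (Hs' : 1 <= sqrt r') by (rewrite <- sqrt_1; apply sqrt_le_1_alt; lra).
  assert (Es : sqrt r * sqrt r = r) by (apply sqrt_sqrt; lra).
  assert (Es' : sqrt r' * sqrt r' = r') by (apply sqrt_sqrt; lra).
  set (a := sqrt r) in *. set (b := sqrt r') in *.
  replace (/ b - / a) with (- ((r' - r) * / (a * b * (a + b)))).
  2:{ rewrite <- Es, <- Es'. field. repeat split; nra. }
  rewrite Rabs_Ropp, Rabs_mult, (Rabs_pos_eq (/ _)) by (apply Rlt_le, Rinv_0_lt_compat; nra).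
  apply Rmult_le_compat; [apply Rabs_pos | apply Rlt_le, Rinv_0_lt_compat; nra | exact Hd |].
  apply Rinv_le_contravar; [lra|]. rewrite <- Es.
  replace (a * b * (a + b)) with (a * a * b + a * b * b) by ring.
  assert (a * a * 1 <= a * a * b) by (apply Rmult_le_compat_l; nra).
  assert (0 <= a * b * b) by (repeat apply Rmult_le_pos; lra). lra.
Qed.

Theorem proposition2p6
  (Omega : plane -> Prop) (kappa : R) (k : plane) (psi1 f1 : plane -> C)
  (omega : plane)
  (HOmega : smooth_bounded_domain Omega)
  (HU : connected (exterior Omega))
  (Hkappa : 0 < kappa)
  (Hk : enorm k = kappa)
  (Hpsi1 : radiation_solution kappa (exterior Omega) psi1)
  (Hf1 : far_field_pattern kappa (exterior Omega) psi1 f1)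
  (Homega : unit_vec omega) :
  (exists M R0 : R, 0 < M /\ 0 < R0 /\
    forall (s : R) (x : plane),
      0 <= s ->
      (forall z, line s omega z -> exterior Omega z) ->
      line s omega x ->
      R0 <= enorm x ->
      exists e : C,
        Cmod e <= M * (1 / Rpower (enorm x) (3 / 2)) /\
        psi1 x = (cexpi (kappa * enorm x) / RtoC (sqrt (enorm x))
                    * f1 (direction x) + e)%C)
  /\
  (forall theta : plane,
    unit_vec theta -> 0 < dot theta omega ->
    exists M R0 : R, 0 < M /\ 0 < R0 /\
    forall (s : R) (x y zeta : plane),
      0 <= s ->
      (forall z, line s omega z -> exterior Omega z) ->
      x = pscal (s / dot theta omega) theta ->
      line s omega x ->
      y = padd x zeta ->
      line s omega y ->
      line 0 omega zeta ->
      Dfun x zeta k <> RtoC 0 ->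
      R0 <= enorm x ->
      R0 <= enorm x / enorm zeta ->
      exists e1 e2 e3 : C,
        Cmod e1 <= M * (enorm zeta / enorm x) /\
        Cmod e2 <= M * (1 / enorm x) /\
        Cmod e3 <= M * (enorm zeta / Rpower (enorm x) (3 / 2)) /\
        let D := Dfun x zeta k in
        let F := f11 psi1 x zeta k in
        f1 theta =
          (F
           - / D * (phase k y - phase k x)
               * (RtoC (Cmod F ^ 2) / RtoC (sqrt (enorm x)))
           + / D * e1
           + / (D * D * D) * (e2 + e3))%C).
Proof.
  destruct HOmega as (_ & _ & _ & HOb & _).
  destruct Hpsi1 as (HC2 & HH & _).
  pose proof Hf1 as (K & Rf & HK & HRf & Hfar).
  split.
  - exists K, Rf. split; [exact HK|]. split; [exact HRf|].
    intros s x _ Hext Hx HR.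
    exists (psi1 x - outgoing_term kappa f1 x)%C. split.
    + replace (K * (1 / Rpower (enorm x) (3 / 2))) with (K / Rpower (enorm x) (3 / 2))
        by (unfold Rdiv; ring).
      apply Hfar; [now apply Hext | exact HR].
    + unfold outgoing_term. ring.
  - intros theta Hth Hto.
    destruct (far_field_lipschitz Omega kappa psi1 f1 theta HOb ltac:(lra) HC2 HH Hf1 Hth)
      as (L & HL & Hlip).
    set (f := f1 theta) in *. set (B := Cmod f).
    assert (HB : 0 <= B) by apply Cmod_ge_0.
    (* The constant of [intensity_expansion] with [B + L], which bounds the pattern in the
       directions of both [x] and [y]. *)
    set (K1 := 2 * K + 2 * (B + L) * K + K ^ 2).
    assert (HK1 : 0 <= K1) by (unfold K1; nra).
    (* The four summands match [T0] to [T3]: the expansion error at [y], and the replacement by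
       values at [x] in the linear term, in the squared modulus and in the inverse square root. *)
    set (K2 := 2 * K1 + 4 * L + 2 * L * (2 * B + 2 * L) + B ^ 2).
    assert (HK2 : K1 <= K2) by (unfold K2; nra).
    destruct (two_point_inversion B K2 HB ltac:(lra)) as (M & HM & Hinv).
    (* The threshold 4 forces [|zeta| <= |x| / 4], hence an angle [|t| <= 1 / 2] within the range of
       the Lipschitz bound and [|y| >= |x| / 2]. The factor 2 then places [y] in the range of the
       expansion as well. *)
    exists M, (Rmax 4 (2 * Rf)). split; [exact HM|].
    assert (HR0 : 4 <= Rmax 4 (2 * Rf) /\ 2 * Rf <= Rmax 4 (2 * Rf))
      by (split; [apply Rmax_l | apply Rmax_r]).
    split; [lra|].
    intros s x y zeta Hs Hext Hx Hxl Hy Hyl _ HD Hxr Hxz.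
    set (r := enorm x) in *.
    assert (Hr : 0 < r) by lra.
    pose proof (enorm_ge_0 zeta) as Hz0.
    assert (Hz : enorm zeta * 4 <= r).
    { destruct (Req_dec (enorm zeta) 0) as [E|E]; [rewrite E; lra|].
      replace r with (enorm zeta * (r / enorm zeta)) by (field; exact E).
      apply Rmult_le_compat_l; lra. }
    set (delta := enorm zeta / r).
    assert (Hd0 : 0 <= delta).
    { apply Rmult_le_pos; [exact Hz0 | now apply Rlt_le, Rinv_0_lt_compat]. }
    assert (Hd4 : delta <= 1 / 4).
    { apply Rmult_le_reg_r with r; [exact Hr|].
      replace (delta * r) with (enorm zeta) by (unfold delta; field; lra). lra. }
    assert (Exr : x = pscal r theta).
    { assert (Hq : 0 <= s / dot theta omega)
        by (apply Rmult_le_pos; [exact Hs | now apply Rlt_le, Rinv_0_lt_compat]).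
      rewrite Hx. f_equal. unfold r. rewrite Hx, enorm_pscal, Hth by exact Hq. ring. }
    assert (Hdx : direction x = theta) by (rewrite Exr; now apply direction_pscal).
    destruct (shifted_direction theta zeta r Hth Hr ltac:(lra)) as (Hyr & t & Ht & Hdy).
    rewrite <- Exr, <- Hy in Hyr, Hdy. fold delta in Ht.
    set (r' := enorm y) in *.
    assert (Hr' : r / 2 <= r').
    { apply Rabs_le_between in Hyr. lra. }
    set (f' := f1 (rotate theta t)) in *.
    assert (Hff : Cmod (f' - f) <= 2 * L * delta).
    { eapply Rle_trans; [apply Hlip; lra|].
      replace (2 * L * delta) with (L * (2 * delta)) by ring.
      now apply Rmult_le_compat_l. }
    assert (Hf' : Cmod f' <= B + L).
    { replace f' with (f + (f' - f))%C by ring.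
      eapply Rle_trans; [apply Cmod_triangle|]. fold B. nra. }
    assert (Ha : Rabs (intensity_a psi1 x k
        - (2 * Re (Cconj (phase k x) * f)%C + Cmod f ^ 2 / sqrt r)) <= K1 * (1 / r)).
    { apply intensity_expansion; [lra | fold B; lra | fold r; lra |].
      specialize (Hfar x (Hext x Hxl) ltac:(fold r; lra)).
      unfold outgoing_term in Hfar. rewrite Hdx in Hfar. now rewrite Hk. }
    assert (Hb : Rabs (intensity_a psi1 y k
        - (2 * Re (Cconj (phase k y) * f')%C + Cmod f' ^ 2 / sqrt r')) <= K1 * (1 / r')).
    { apply intensity_expansion; [lra | exact Hf' | fold r'; lra |].
      specialize (Hfar y (Hext y Hyl) ltac:(fold r'; lra)).
      unfold outgoing_term in Hfar. rewrite Hdy in Hfar. now rewrite Hk. }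
    assert (Hir : 0 < 1 / r) by (apply Rdiv_lt_0_compat; lra).
    assert (Hir' : 1 / r' <= 2 * (1 / r)).
    { replace (2 * (1 / r)) with (1 / (r / 2)) by (field; lra).
      unfold Rdiv. rewrite !Rmult_1_l. apply Rinv_le_contravar; lra. }
    assert (Hb2 : Rabs (intensity_a psi1 y k
        - (2 * Re (Cconj (phase k y) * f)%C + Cmod f ^ 2 / sqrt r)) <= K2 * (delta + 1 / r)).
    { set (q := phase k y) in *.
      assert (Eb : intensity_a psi1 y k - (2 * Re (Cconj q * f)%C + Cmod f ^ 2 / sqrt r)
        = (intensity_a psi1 y k - (2 * Re (Cconj q * f')%C + Cmod f' ^ 2 / sqrt r'))
          + 2 * Re (Cconj q * (f' - f))%C
          + (Cmod f' ^ 2 - Cmod f ^ 2) * / sqrt r'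
          + Cmod f ^ 2 * (/ sqrt r' - / sqrt r)).
      { replace (Re (Cconj q * (f' - f))%C) with (Re (Cconj q * f')%C - Re (Cconj q * f)%C).
        - unfold Rdiv. ring.
        - generalize (Cconj q). intros c. destruct c, f, f'.
          unfold Re, Cmult, Cminus, Cplus, Copp; simpl. ring. }
      rewrite Eb.
      assert (T1 : Rabs (2 * Re (Cconj q * (f' - f))%C) <= 4 * L * delta).
      { rewrite Rabs_mult, (Rabs_pos_eq 2) by lra.
        pose proof (Rabs_Re_conj_mul_le q (f' - f)) as H.
        rewrite (Cmod_cexpi _ : Cmod q = 1) in H. lra. }
      assert (T2 : Rabs ((Cmod f' ^ 2 - Cmod f ^ 2) * / sqrt r')
          <= 2 * L * delta * (2 * B + 2 * L)).
      { assert (H1 : 1 <= sqrt r') by (rewrite <- sqrt_1; apply sqrt_le_1_alt; lra).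
        rewrite Rabs_mult, (Rabs_pos_eq (/ sqrt r')) by (apply Rlt_le, Rinv_0_lt_compat; lra).
        rewrite <- Rmult_1_r.
        apply Rmult_le_compat; [apply Rabs_pos | apply Rlt_le, Rinv_0_lt_compat; lra | |].
        - eapply Rle_trans; [apply Cmod_sqr_sub_le|]. fold B.
          pose proof (Cmod_ge_0 (f' - f)).
          apply Rmult_le_compat; [assumption | lra | exact Hff | nra].
        - rewrite <- Rinv_1. apply Rinv_le_contravar; lra. }
      assert (T3 : Rabs (Cmod f ^ 2 * (/ sqrt r' - / sqrt r)) <= B ^ 2 * delta).
      { fold B. rewrite Rabs_mult, (Rabs_pos_eq (B ^ 2)) by apply pow2_ge_0.
        apply Rmult_le_compat_l; [apply pow2_ge_0|].
        apply inv_sqrt_sub_le; [lra | lra | exact Hyr]. }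
      assert (T0 : K1 * (1 / r') <= 2 * K1 * (1 / r)).
      { replace (2 * K1 * (1 / r)) with (K1 * (2 * (1 / r))) by ring.
        now apply Rmult_le_compat_l. }
      eapply Rle_trans; [apply Rabs_triang|].
      eapply Rle_trans; [apply Rplus_le_compat_r, Rabs_triang|].
      eapply Rle_trans; [apply Rplus_le_compat_r, Rplus_le_compat_r, Rabs_triang|].
      apply Rle_trans with (2 * K1 * (1 / r) + 4 * L * delta
        + 2 * L * delta * (2 * B + 2 * L) + B ^ 2 * delta); [lra|].
      assert (0 <= (K2 - 2 * K1) * (1 / r)).
      { apply Rmult_le_pos; [|lra]. unfold K2. nra. }
      assert (0 <= (2 * K1) * delta) by (apply Rmult_le_pos; lra).
      unfold K2 in *. lra. }
    assert (HDe : Dfun x zeta k = (RtoC 2 * Ci * RtoC (sin ((dot k y - enorm k * enorm y)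
        - (dot k x - enorm k * enorm x))))%C).
    { assert (Edot : dot k y = dot k x + dot k zeta).
      { rewrite Hy. unfold dot, padd; simpl. ring. }
      unfold Dfun. rewrite <- Hy, Edot. do 3 f_equal. ring. }
    destruct (Hinv (dot k x - enorm k * enorm x) (dot k y - enorm k * enorm y) r delta
      (intensity_a psi1 x k) (intensity_a psi1 y k) f) as (e1 & e2 & e3 & He1 & He2 & He3 & E).
    + apply Rle_refl.
    + lra.
    + lra.
    + rewrite <- HDe. exact HD.
    + eapply Rle_trans; [exact Ha|]. apply Rmult_le_compat_r; lra.
    + exact Hb2.
    + exists e1, e2, e3. split; [exact He1|]. split; [exact He2|]. split.
      * rewrite Rpower_three_halves by exact Hr.
        replace (enorm zeta / (r * sqrt r)) with (delta / sqrt r); [exact He3|].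
        unfold delta. field. split; [|lra].
        apply Rgt_not_eq. now apply sqrt_lt_R0.
      * cbv zeta. unfold f11. rewrite <- Hy, HDe. exact E.
Qed.
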